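(* Let $M$ be a meridian surface of type $\mathcal{M}'_a$, i.e. $z(u,v)=f(u)\,l(v)+g(u)\,e_4$ with $l$ a spacelike unit-speed curve on $\mathbb{S}^2_1(1)\subset \mathrm{span}\{e_1,e_2,e_3\}$ (respectively, of type $\widetilde{\mathcal{M}}''_b$, i.e. $z(u,v)=g(u)\,e_1+f(u)\,l(v)$ with $l$ a timelike unit-speed curve on $\mathbb{H}^2_1(-1)\subset \mathrm{span}\{e_2,e_3,e_4\}$), where $f'^2-g'^2=-1$. Let $\kappa$ be the spherical curvature of $l$, and assume $\kappa\neq0$. Then $M$ has parallel normalized mean curvature vector field but not parallel mean curvature vector field if and only if one of the following cases holds: (i) $\kappa\neq0$ and the meridian is defined by $$f(u)=\pm\sqrt{-u^2+2au+b},\qquad g(u)=\pm\sqrt{a^2+b}\,\arcsin\frac{u-a}{\sqrt{a^2+b}}+c,$$ where $a=\mathrm{const}$, $b=\mathrm{const}$, $c=\mathrm{const}$. (ii) the curve $l$ has non-zero constant spherical curvature and the meridian is determined by $f'=\varphi(f)$, where $$\varphi(t)=\pm\frac1t\sqrt{(ct+a)^2-t^2},\qquad a=\mathrm{const},\quad c=\mathrm{const}\neq0,\quad c^2\neq\kappa^2,$$ and $g$ is defined by $g'=\sqrt{f'^2+1}$.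
   Context: Ambient space: $\mathbb{E}^4_2$ is $\mathbb{R}^4$ with the metric $\langle\cdot,\cdot\rangle=dx_1^2+dx_2^2-dx_3^2-dx_4^2$; $e_1,e_2,e_3,e_4$ is an orthonormal basis with $\langle e_1,e_1\rangle=\langle e_2,e_2\rangle=1$, $\langle e_3,e_3\rangle=\langle e_4,e_4\rangle=-1$. A vector $v$ is spacelike if $\langle v,v\rangle>0$ or $v=0$, timelike if $\langle v,v\rangle<0$. Meridian surfaces: $f,g$ are smooth real functions on an interval $I$, $f$ nowhere zero; $l$ is a smooth curve on an interval $J$; $u\in I$, $v\in J$. The curve $u\mapsto(f(u),g(u))$ is called the meridian. Type $\mathcal{M}'_a$: $z(u,v)=f(u)l(v)+g(u)e_4$, where $l(v)=\cosh w^1\cos w^2\,e_1+\cosh w^1\sin w^2\,e_2+\sinh w^1\,e_3$ with $w^1=w^1(v)$, $w^2=w^2(v)$ smooth, a curve on $\mathbb{S}^2_1(1)=\{V\in\mathrm{span}\{e_1,e_2,e_3\}:\langle V,V\rangle=1\}$ with $\langle l',l'\rangle=1$, and $f'^2-g'^2=-1$. The first fundamental form is $E=-1$, $F=0$, $G=f^2$. Type $\widetilde{\mathcal{M}}''_b$: $z(u,v)=g(u)e_1+f(u)l(v)$, where $l(v)=\sinh w^1\,e_2+\cosh w^1\cos w^2\,e_3+\cosh w^1\sin w^2\,e_4$ with $w^1,w^2$ smooth functions of $v$, a curve on $\mathbb{H}^2_1(-1)=\{V\in\mathrm{span}\{e_2,e_3,e_4\}:\langle V,V\rangle=-1\}$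 with $\langle l',l'\rangle=-1$, and $f'^2-g'^2=-1$. The first fundamental form is $E=1$, $F=0$, $G=-f^2$. Both are Lorentz surfaces (induced metric of signature $(1,1)$). Spherical curvature: let $t=l'$ and let $n(v)$ be the vector field, unique up to sign, in the 3-dimensional space containing $l$, such that $\{l,t,n\}$ is an orthonormal frame. The spherical curvature of $l$ is $\kappa(v)=\langle t'(v),n(v)\rangle$. Mean curvature: $h$ is the second fundamental form, $H=\tfrac12\,\mathrm{tr}\,h$ is the mean curvature vector field, $D$ is the normal connection. The surface has parallel mean curvature vector field if $DH=0$ identically. It has parallel normalized mean curvature vector field if $H$ is non-zero, $\langle H,H\rangle\neq0$, and there is a unit vector field $b$ in the direction of $H$ which is parallel in the normal bundle, i.e. $Db=0$ identically.
   Formalization: In case (ii) f is also required to be non-constant (constant solutions of f'=φ(f) give parallel H), the sign in φ may vary with u (f' can change sign at a turning point), and g'=±√(f'^2+1) with a constant sign, since g' may be negative. *)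

(* Defs.v *)
From HB Require Import structures.
From mathcomp Require Import all_boot all_order all_algebra.
From mathcomp Require Import all_classical all_reals all_analysis.
Set Implicit Arguments.
Unset Strict Implicit.
Unset Printing Implicit Defensive.
Import Order.TTheory GRing.Theory Num.Theory numFieldNormedType.Exports.
Local Open Scope classical_set_scope.
Local Open Scope ring_scope.

Section E42.
Variable R : realType.
Implicit Types x y : 'rV[R]_4.

Definition cosh (t : R) : R := (expR t + expR (- t)) / 2.
Definition sinh (t : R) : R := (expR t - expR (- t)) / 2.

(* The neutral metric dx1^2 + dx2^2 - dx3^2 - dx4^2. *)
Definition sprod x y : R :=
  \sum_(i < 4) (if (i < 2)%N then 1 else -1) * x 0 i * y 0 i.

(* Basis vectors are numbered from 1, as in e_1, ..., e_4. *)
Definition e (k : nat) : 'rV[R]_4 := \row_(i < 4) (i.+1 == k)%:R.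

Definition span3 (i j k : nat) : set 'rV[R]_4 :=
  [set x | exists a b c : R, x = a *: e i + b *: e j + c *: e k].

Definition unitv x : Prop := sprod x x = 1 \/ sprod x x = -1.

Definition orthonormal3 (x y w : 'rV[R]_4) : Prop :=
  [/\ unitv x, unitv y & unitv w] /\
  [/\ sprod x y = 0, sprod x w = 0 & sprod y w = 0].

(* Derivatives are only meaningful at interior points, hence open intervals
   (possibly unbounded). *)
Definition open_interval (I : set R) : Prop :=
  [/\ open I, is_interval I & I !=set0].

Definition smooth_on (V : normedModType R) (I : set R) (f : R -> V) : Prop :=
  forall (k : nat) (t : R), I t -> derivable (derive1n k f) t 1.

Section TwoVariables.
Variable V : normedModType R.

Definition du (F : R -> R -> V) : R -> R -> V := fun u v => derive1 (F ^~ v) u.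
Definition dv (F : R -> R -> V) : R -> R -> V := fun u v => derive1 (F u) v.

Definition iter_partial (s : seq bool) (F : R -> R -> V) : R -> R -> V :=
  foldr (fun (b : bool) G => if b then du G else dv G) F s.

(* All iterated partial derivatives are Frechet differentiable on I x J. *)
Definition smooth2_on (I J : set R) (F : R -> R -> V) : Prop :=
  forall (s : seq bool) (u v : R), I u -> J v ->
    differentiable (fun p : R * R => iter_partial s F p.1 p.2) (u, v).

End TwoVariables.

Section Surface.
Variable z : R -> R -> 'rV[R]_4.

Definition ffE (u v : R) : R := sprod (du z u v) (du z u v).
Definition ffF (u v : R) : R := sprod (du z u v) (dv z u v).
Definition ffG (u v : R) : R := sprod (dv z u v) (dv z u v).
Definition ffW (u v : R) : R := ffE u v * ffG u v - ffF u v ^+ 2.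

(* Orthogonal projection of w onto the tangent plane spanned by z_u, z_v, which
   is nondegenerate when ffW is nonzero: the coefficients solve the linear
   system with Gram matrix (E, F; F, G). *)
Definition tangent_part (u v : R) (w : 'rV[R]_4) : 'rV[R]_4 :=
  let p := sprod w (du z u v) in
  let q := sprod w (dv z u v) in
  ((ffG u v * p - ffF u v * q) / ffW u v) *: du z u v +
  ((ffE u v * q - ffF u v * p) / ffW u v) *: dv z u v.

Definition normal_part (u v : R) (w : 'rV[R]_4) : 'rV[R]_4 :=
  w - tangent_part u v w.

(* h(z_u, z_u), h(z_u, z_v), h(z_v, z_v) by the Gauss formula. *)
Definition h11 (u v : R) := normal_part u v (du (du z) u v).
Definition h12 (u v : R) := normal_part u v (du (dv z) u v).
Definition h22 (u v : R) := normal_part u v (dv (dv z) u v).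

(* The trace of h is g^{ij} h_{ij}, with g^{ij} the inverse of the first
   fundamental form. *)
Definition mean_curvature (u v : R) : 'rV[R]_4 :=
  2^-1 *: ((ffW u v)^-1 *:
    (ffG u v *: h11 u v - (2 * ffF u v) *: h12 u v + ffE u v *: h22 u v)).

(* D xi = 0, where D_X xi is the normal part of the derivative of xi along X. *)
Definition normal_parallel (I J : set R) (xi : R -> R -> 'rV[R]_4) : Prop :=
  forall u v : R, I u -> J v ->
    normal_part u v (du xi u v) = 0 /\ normal_part u v (dv xi u v) = 0.

Definition parallel_mean_curvature (I J : set R) : Prop :=
  normal_parallel I J mean_curvature.

Definition parallel_normalized_mean_curvature (I J : set R) : Prop :=
  (forall u v : R, I u -> J v ->
     mean_curvature u v <> 0 /\
     sprod (mean_curvature u v) (mean_curvature u v) <> 0) /\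
  exists b : R -> R -> 'rV[R]_4,
    [/\ smooth2_on I J b,
        forall u v : R, I u -> J v -> unitv (b u v),
        forall u v : R, I u -> J v ->
          exists lam : R, 0 < lam /\ mean_curvature u v = lam *: b u v
      & normal_parallel I J b].

End Surface.

Definition curve_a (w1 w2 : R -> R) (v : R) : 'rV[R]_4 :=
  (cosh (w1 v) * cos (w2 v)) *: e 1 + (cosh (w1 v) * sin (w2 v)) *: e 2
  + sinh (w1 v) *: e 3.

Definition curve_b (w1 w2 : R -> R) (v : R) : 'rV[R]_4 :=
  sinh (w1 v) *: e 2 + (cosh (w1 v) * cos (w2 v)) *: e 3
  + (cosh (w1 v) * sin (w2 v)) *: e 4.

Definition surface_a (f g : R -> R) (l : R -> 'rV[R]_4) (u v : R) : 'rV[R]_4 :=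
  f u *: l v + g u *: e 4.

Definition surface_b (f g : R -> R) (l : R -> 'rV[R]_4) (u v : R) : 'rV[R]_4 :=
  g u *: e 1 + f u *: l v.

Definition meridian_curve (I : set R) (f g : R -> R) : Prop :=
  [/\ open_interval I, smooth_on I f, smooth_on I g,
      forall u : R, I u -> f u <> 0
    & forall u : R, I u -> derive1 f u ^+ 2 - derive1 g u ^+ 2 = -1].

Definition curve_parameters (J : set R) (w1 w2 : R -> R) : Prop :=
  [/\ open_interval J, smooth_on J w1 & smooth_on J w2].

(* eps is the causal character of the unit-speed curve l. *)
Definition unit_speed (eps : R) (J : set R) (l : R -> 'rV[R]_4) : Prop :=
  forall v : R, J v -> sprod (derive1 l v) (derive1 l v) = eps.

(* n completes l and t = l' to an orthonormal frame of the 3-space S. *)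
Definition spherical_normal (S : set 'rV[R]_4) (J : set R)
    (l n : R -> 'rV[R]_4) : Prop :=
  smooth_on J n /\
  forall v : R, J v -> S (n v) /\ orthonormal3 (l v) (derive1 l v) (n v).

Definition spherical_curvature (l n : R -> 'rV[R]_4) (v : R) : R :=
  sprod (derive1 (derive1 l) v) (n v).

(* f is nonzero, so the radicand is positive on I. *)
Definition case_i (I J : set R) (f g kappa : R -> R) : Prop :=
  (forall v : R, J v -> kappa v <> 0) /\
  exists a b c s1 s2 : R,
    [/\ s1 = 1 \/ s1 = -1, s2 = 1 \/ s2 = -1
      & forall u : R, I u ->
          f u = s1 * Num.sqrt (- u ^+ 2 + 2 * a * u + b) /\
          g u = s2 * Num.sqrt (a ^+ 2 + b)
                * asin ((u - a) / Num.sqrt (a ^+ 2 + b)) + c].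

Definition radicand (a c t : R) : R := (c * t + a) ^+ 2 - t ^+ 2.
Definition phi (s a c t : R) : R := s * t^-1 * Num.sqrt (radicand a c t).

(* - The sign in phi may depend on u, so that meridians on which f' changes sign
     are covered; by continuity it is locally constant where f' is nonzero.
   - Num.sqrt vanishes on negative numbers, so the domain of phi is explicit.
   - The equation f' = phi(f) also has stationary solutions, f equal to a zero
     of phi; they give parallel mean curvature and are excluded.
   - g' is the square root up to the reflection g |-> -g of the meridian. *)
Definition case_ii (I J : set R) (f g kappa : R -> R) : Prop :=
  exists k a c : R,
    [/\ k <> 0 /\ (forall v : R, J v -> kappa v = k),
        c <> 0 /\ c ^+ 2 <> k ^+ 2,
        forall u : R, I u ->
          0 <= radicand a c (f u) /\
          (derive1 f u = phi 1 a c (f u) \/ derive1 f u = phi (-1) a c (f u)),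
        exists u1 u2 : R, [/\ I u1, I u2 & f u1 <> f u2]
      & exists s : R, (s = 1 \/ s = -1) /\
          forall u : R, I u -> derive1 g u = s * Num.sqrt (derive1 f u ^+ 2 + 1)].

End E42.

Arguments e {R} k.
Arguments span3 {R} i j k.

(* Main.v *)
From HB Require Import structures.
Require Import Defs.
From mathcomp Require Import all_boot all_order all_algebra.
From mathcomp Require Import all_classical all_reals all_analysis.
From mathcomp Require Import ring lra.
Import Order.TTheory GRing.Theory Num.Theory numFieldNormedType.Exports.
Local Open Scope classical_set_scope.
Local Open Scope ring_scope.

(** Changing the sign of the metric and permuting the coordinates turns the second
    type of surface into the first, so both are treated at once: with [eta = 1] or
    [eta = -1], the surface is [z = f l + g e0] where [l] and [t = l'] have square
    [eta], while [n] and [e0] have square [- eta].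

    The normal bundle is spanned by [n] and [N = g' l + f' e0]. Since
    [n' = - eta kappa t], [N_v = g' t] and [N_u] is a multiple of [z_u], both fields
    are parallel in the normal bundle; hence a normal field is parallel exactly when
    its coefficients on [n] and [N] are constant. The mean curvature vector is
      [H = - (kappa n + eta Q N) / (2 f)]  with  [Q = f (f'' g' - g'' f') + g'],
    a function of [u] alone, and [<H, H>] is a nonzero multiple of
    [Q^2 - kappa^2]. Therefore the direction of [H] is parallel if and only if
    [Q(u) = rho kappa(v)] for a constant [rho], which must satisfy [rho^2 <> 1]
    because [<H, H> <> 0] ([factor_of_pnmc], [pnmc_of_factor]); and then [H] itself is
    parallel if and only if [f] is constant ([parallel_mean_curvatureP]): [kappa / f]
    is then a constant, and conversely [Q = g' <> 0] forces [kappa] to be constant.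

    It remains to solve an ordinary differential equation
    ([meridian_classification]). From [f'^2 - g'^2 = -1] one gets
      [Q g' = f f'' + f'^2 + 1 = (f^2 + u^2)'' / 2]  and  [Q f' = (f g')'].
    If [rho = 0], then [f^2 + u^2] is affine in [u], which is case (i), and [g] is
    found by quadrature. If [rho <> 0], both sides of [Q(u) = rho kappa(v)] are
    constants, [Q = c], so that [f g' - c f] is a constant [a] and
    [f^2 f'^2 = (c f + a)^2 - f^2], which is case (ii). In the converse of (ii) the
    equation [f' = phi(f)] only gives [(Q - c) f' = 0], up to the sign of [c], and
    pieces on which [f] is stationary have to be excluded; continuity of [Q] on the
    whole interval does this ([factor_of_case_ii]). *)

(** * One-variable calculus *)

Section Calculus.
Context {R : realType}.
Implicit Types (I J : set R) (t u v : R).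

Lemma is_derive_derive1 {V : normedModType R} {f : R -> V} {t} :
  derivable f t 1 -> is_derive t 1 f (derive1 f t).
Proof. by move=> df; rewrite derive1E; exact: derivableP. Qed.

Lemma derive1_val {V : normedModType R} {f : R -> V} {t d} :
  is_derive t 1 f d -> derive1 f t = d.
Proof. by move=> df; rewrite derive1E derive_val. Qed.

Lemma is_derive_eqfun_on {V : normedModType R} {I} {f g : R -> V} {t d} :
  open I -> (forall s, I s -> f s = g s) -> I t ->
  is_derive t 1 g d -> is_derive t 1 f d.
Proof.
move=> oI fg It dg; apply: near_eq_is_derive dg.
apply: filterS (open_nbhs_nbhs (conj oI It)) => s Is.
by rewrite fg.
Qed.

Lemma derive1_eqfun_on {V : normedModType R} {I} {f g : R -> V} :
  open I -> (forall s, I s -> f s = g s) ->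
  forall t, I t -> derive1 f t = derive1 g t.
Proof.
move=> oI fg t It; rewrite !derive1E; apply: near_eq_derive.
by apply: filterS (open_nbhs_nbhs (conj oI It)) => s /fg.
Qed.

Lemma is_derive_scalel {V : normedModType R} {f : R -> R} (x : V) {t d} :
  is_derive t 1 f d -> is_derive t 1 (fun s => f s *: x) (d *: x).
Proof.
move=> [df dfE].
suff H : h^-1 *: (((fun s => f s *: x) \o shift t) (h *: (1 : R)) - f t *: x)
    @[h --> 0^'] --> d *: x.
  by split; [apply/cvg_ex; exists (d *: x)|exact: cvg_lim H].
have {}dfE : h^-1 *: ((f \o shift t) (h *: (1 : R)) - f t) @[h --> 0^'] --> d.
  by rewrite -dfE; exact: df.
rewrite [X in X @ _ --> _](_ : _ = fun h : R =>
    (h^-1 *: ((f \o shift t) (h *: (1 : R)) - f t)) *: x).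
  exact: cvgZr_tmp dfE.
by apply/funext => h /=; rewrite -scalerBl !scalerA.
Qed.

Lemma is_derive_add {V : normedModType R} {f g : R -> V} {t a b} :
  is_derive t 1 f a -> is_derive t 1 g b ->
  is_derive t 1 (fun s => f s + g s) (a + b).
Proof. by move=> df dg; exact: (is_deriveD df dg). Qed.

Lemma is_derive_scaler {V : normedModType R} (k : R) {f : R -> V} {t a} :
  is_derive t 1 f a -> is_derive t 1 (fun s => k *: f s) (k *: a).
Proof. by move=> df; exact: (is_deriveZ k df). Qed.

Lemma is_derive_mul {f g : R -> R} {t a b} :
  is_derive t 1 f a -> is_derive t 1 g b ->
  is_derive t 1 (fun s => f s * g s) (a * g t + f t * b).
Proof.
move=> df dg; apply: is_derive_eq (is_deriveM df dg) _.
by rewrite /GRing.scale /= addrC [g t * a]mulrC.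
Qed.

Lemma is_derive_sqr {f : R -> R} {t a} :
  is_derive t 1 f a -> is_derive t 1 (fun s => f s ^+ 2) (2 * f t * a).
Proof.
move=> df; under eq_fun do rewrite expr2.
by apply: is_derive_eq (is_derive_mul df df) _; ring.
Qed.

Lemma is_derive_coord {X : R -> 'rV[R]_4} {t a} (i : 'I_4) :
  is_derive t 1 X a -> is_derive t 1 (fun s => X s 0 i) (a 0 i).
Proof.
move=> [dX <-]; have dXi := (derivable_mxP X t 1).1 dX 0 i.
by split=> //; rewrite derive_mx // mxE.
Qed.

Lemma is_derive_sprod {X Y : R -> 'rV[R]_4} {t a b} :
  is_derive t 1 X a -> is_derive t 1 Y b ->
  is_derive t 1 (fun s => sprod (X s) (Y s)) (sprod a (Y t) + sprod (X t) b).
Proof.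
move=> dX dY.
have := @is_derive_sum _ _ _ 4 (fun i s => (if (i < 2)%N then 1 else -1)
   * X s 0 i * Y s 0 i) t 1 _ (fun i => is_derive_mul
     (is_derive_scaler (if (i < 2)%N then 1 else -1 : R) (is_derive_coord i dX))
     (is_derive_coord i dY)).
rewrite /sprod -big_split /= => H.
by rewrite fct_sumE in H.
Qed.

Lemma zero_derive_constant {I} (f : R -> R) : is_interval I ->
  (forall t, I t -> is_derive t 1 f 0) ->
  forall s t, I s -> I t -> f s = f t.
Proof.
move=> itI df.
suff H s t : s <= t -> I s -> I t -> f s = f t.
  by move=> s t Is It; have [/H->|/ltW/H->] := leP s t.
move=> st Is It.
have sub x : x \in `[s, t] -> I x by rewrite inE /= => xst; exact: (itI _ _ Is It).
have [||c _] := @MVT_segment R f (cst 0) s t st.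
- by move=> x xst; apply: df; apply: sub; apply: subset_itv_oo_cc.
- apply: derivable_within_continuous => x /sub Ix.
  by have [] := df _ Ix.
by rewrite mul0r => /eqP; rewrite subr_eq0 => /eqP.
Qed.

Lemma nonvanishing_sign {I} {f : R -> R} : is_interval I ->
  (forall t, I t -> {for t, continuous f}) -> (forall t, I t -> f t != 0) ->
  (forall t, I t -> 0 < f t) \/ (forall t, I t -> f t < 0).
Proof.
move=> itI cf f0.
suff H s t : I s -> I t -> 0 < f s -> 0 < f t.
  have [[s [Is fs]]|no] := pselect (exists s, I s /\ 0 < f s).
    by left=> t It; exact: H fs.
  right=> t It; rewrite lt_neqAle f0 //= leNgt.
  by apply/negP => ft; apply: no; exists t.
move=> Is It fs; rewrite ltNge; apply/negP => ft.
have K a b : a <= b -> I a -> I b ->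
    Num.min (f a) (f b) <= 0 <= Num.max (f a) (f b) -> False.
  move=> ab Ia Ib f0b.
  have sub x : x \in `[a, b] -> I x by rewrite inE /= => xab; exact: (itI _ _ Ia Ib).
  have [|c /sub Ic /eqP] := IVT ab _ f0b; last exact/negP/f0.
  apply/continuous_in_subspaceT => x; rewrite inE => /= xab.
  by apply: cf; apply: sub.
have [st|/ltW ts] := leP s t.
- by apply: (K s t) => //; rewrite ge_min le_max ft (ltW fs) orbT.
- by apply: (K t s) => //; rewrite ge_min le_max ft (ltW fs) orbT.
Qed.

(** Two distinct values [p] and [q] would be separated by [(p + q) / 2], a value that
    the function never takes. *)
Lemma two_valued_constant {I} {f : R -> R} {p q} : is_interval I ->
  (forall t, I t -> {for t, continuous f}) ->
  (forall t, I t -> f t = p \/ f t = q) ->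
  (forall t, I t -> f t = p) \/ (forall t, I t -> f t = q).
Proof.
move=> itI cf fpq.
have [pq|pq] := eqVneq p q; first by left=> t /fpq[] ->.
have [||H|H] := @nonvanishing_sign I (fun t => (f t - (p + q) / 2) * (p - q)) itI.
- move=> t It; apply: cvgM; last exact: cvg_cst.
  by apply: cvgB; [exact: cf|exact: cvg_cst].
- move=> t /fpq[] ->; rewrite mulf_neq0 ?subr_eq0 //; apply/eqP; move/eqP: pq; lra.
- left=> t It; have := H _ It; have [//|->] := fpq _ It.
  rewrite (_ : _ * _ = - ((p - q) ^+ 2 / 2)); last by field.
  by rewrite oppr_gt0 ltNge divr_ge0 ?sqr_ge0.
- right=> t It; have := H _ It; have [->|//] := fpq _ It.
  rewrite (_ : _ * _ = ((p - q) ^+ 2 / 2)); last by field.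
  by rewrite ltNge divr_ge0 ?sqr_ge0.
Qed.

Lemma is_derive_continuous {f : R -> R} {t d} : is_derive t 1 f d -> {for t, continuous f}.
Proof.
by move=> [df _]; apply: differentiable_continuous; exact/derivable1_diffP.
Qed.

End Calculus.

(** * Smooth functions of one and two variables *)

Section Differentiable.
Context {R : realType}.

Lemma near_eq_differentiable {V W : normedModType R} {f h : V -> W} {x : V} :
  (\forall y \near x, f y = h y) -> differentiable h x -> differentiable f x.
Proof.
move=> fh dh; have fhx : f x = h x by exact: nbhs_singleton fh.
have dE : f \o shift x = cst (f x) + 'd h x +o_ 0 id.
  have [_ /eqaddoP dh'] := (diff_locallyP _ _).1 dh.
  have fh0 : \forall y \near 0, f (y + x) = h (y + x).
    by move: fh; rewrite (near_shift 0) subr0.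
  apply/eqaddoP => eps eps0; apply: filterS2 fh0 (dh' _ eps0) => y yE.
  by rewrite !fctE /= yE fhx.
apply/diff_locallyP; have cd : continuous ('d h x) by exact: diff_continuous.
by rewrite (diff_unique cd dE).
Qed.

Lemma differentiable_fst (x : R * R) : differentiable (fst : R * R -> R) x.
Proof.
have lf : linear (fst : R * R -> R) by [].
pose fM := GRing.isLinear.Build _ _ _ _ _ lf.
pose F : {linear _ -> _} := HB.pack (fst : R * R -> R) fM.
apply: (@linear_differentiable _ _ _ F) => y; exact: cvg_fst.
Qed.

Lemma differentiable_snd (x : R * R) : differentiable (snd : R * R -> R) x.
Proof.
have lf : linear (snd : R * R -> R) by [].
pose fM := GRing.isLinear.Build _ _ _ _ _ lf.
pose F : {linear _ -> _} := HB.pack (snd : R * R -> R) fM.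
apply: (@linear_differentiable _ _ _ F) => y; exact: cvg_snd.
Qed.

End Differentiable.

Section Smooth.
Context {R : realType}.
Implicit Types I J : set R.

Lemma smooth_is_derive {V : normedModType R} {A : set R} {h : R -> V} k t :
  smooth_on A h -> A t -> is_derive t 1 (derive1n k h) (derive1n k.+1 h t).
Proof. by move=> hs At; exact: is_derive_derive1 (hs k t At). Qed.

(** Coinduction: a class of functions stable under differentiation on [I]
    consists of smooth functions. *)
Lemma smooth_coind {V : normedModType R} {I} (P : (R -> V) -> Prop) : open I ->
  (forall f, P f -> exists2 h, P h & forall t, I t -> is_derive t 1 f (h t)) ->
  forall f, P f -> smooth_on I f.
Proof.
move=> oI Pd f Pf k t It.
have [h Ph hE] : exists2 h, P h & forall s, I s -> derive1n k f s = h s.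
  elim: k => [|k [h Ph hE]]; first by exists f.
  have [h' Ph' dh] := Pd _ Ph; exists h' => // s Is.
  by rewrite derive1nS (derive1_eqfun_on oI hE) // (derive1_val (dh _ Is)).
have [h' _ dh] := Pd _ Ph.
by have [] := is_derive_eqfun_on oI hE It (dh _ It).
Qed.

Lemma smooth_derive {V : normedModType R} {I} {f : R -> V} :
  smooth_on I f -> smooth_on I (derive1 f).
Proof. by move=> fs k t It; rewrite -derive1Sn; exact: fs. Qed.

(** A class that is visibly stable under differentiation, hence made of smooth
    functions; it gives the smoothness of the coordinates of [l]. *)
Inductive elementary I : (R -> R) -> Prop :=
| elem_smooth f : smooth_on I f -> elementary I f
| elem_cst c : elementary I (cst c)
| elem_add f h : elementary I f -> elementary I h -> elementary I (fun t => f t + h t)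
| elem_mul f h : elementary I f -> elementary I h -> elementary I (fun t => f t * h t)
| elem_exp f : elementary I f -> elementary I (expR \o f)
| elem_cos f : elementary I f -> elementary I (cos \o f)
| elem_sin f : elementary I f -> elementary I (sin \o f).

Lemma elementary_smooth {I f} : open I -> elementary I f -> smooth_on I f.
Proof.
move=> oI; move: f; apply: (smooth_coind _ oI) => f.
elim=> {f} [f fs|c|f h ef [f' ef' df] eh [h' eh' dh]|f h ef [f' ef' df] eh [h' eh' dh]
  |f ef [f' ef' df]|f ef [f' ef' df]|f ef [f' ef' df]].
- exists (derive1 f); first exact/elem_smooth/smooth_derive.
  by move=> t; exact: (smooth_is_derive 0 _ fs).
- by exists (cst 0) => [|t It]; [exact: elem_cst|exact: is_derive_cst].
- exists (fun t => f' t + h' t); first exact: elem_add.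
  by move=> t It; apply: is_derive_add; [exact: df|exact: dh].
- exists (fun t => f' t * h t + f t * h' t); first by apply: elem_add; exact: elem_mul.
  by move=> t It; apply: is_derive_mul; [exact: df|exact: dh].
- exists (fun t => (expR \o f) t * f' t); first by apply: elem_mul => //; exact: elem_exp.
  by move=> t It; apply: is_derive1_comp; exact: df.
- exists (fun t => (cst (-1) t * (sin \o f) t) * f' t).
    by do ![apply: elem_mul] => //; [exact: elem_cst|exact: elem_sin].
  move=> t It; rewrite /= mulN1r; apply: is_derive1_comp; exact: df.
- exists (fun t => (cos \o f) t * f' t); first by apply: elem_mul => //; exact: elem_cos.
  by move=> t It; apply: is_derive1_comp; exact: df.
Qed.

Lemma is_derive_coordP {X : R -> 'rV[R]_4} {t : R} {a : 'rV[R]_4} :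
  (forall i, is_derive t 1 (fun s => X s 0 i) (a 0 i)) -> is_derive t 1 X a.
Proof.
move=> dX.
have XD : derivable X t 1 by apply/derivable_mxP => i j; rewrite ord1; have [] := dX j.
split=> //; rewrite derive_mx //; apply/rowP => j; rewrite mxE.
by have [_] := dX j.
Qed.

Lemma smooth_on_coordP {I} {X : R -> 'rV[R]_4} : open I ->
  smooth_on I X <-> forall i, smooth_on I (fun t => X t 0 i).
Proof.
move=> oI; split=> [Xs i|Xs].
  apply: (smooth_coind (fun f => exists2 X : R -> 'rV[R]_4,
    smooth_on I X & f = fun t => X t 0 i) oI).
    move=> _ [Y Ys ->]; exists (fun t => derive1 Y t 0 i).
      by exists (derive1 Y); [exact: smooth_derive|].
    by move=> t It; apply: is_derive_coord; exact: (smooth_is_derive 0 _ Ys).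
  by exists X.
apply: (smooth_coind (fun X : R -> 'rV[R]_4 =>
  forall i, smooth_on I (fun t => X t 0 i)) oI); last exact: Xs.
move=> Y Ys; exists (fun t => \row_i derive1 (fun s => Y s 0 i) t).
  move=> i; under eq_fun do rewrite mxE; exact: smooth_derive.
move=> t It; apply: is_derive_coordP => i; rewrite mxE.
exact: (smooth_is_derive 0 _ (Ys i)).
Qed.

End Smooth.

Section Separable.
Context {R : realType} {V : normedModType R} (I J : set R).

(** Finite sums of products of a function of [u], a function of [v] and a constant
    vector, up to equality on [I x J]. The class is stable under both partial
    derivatives and its members are differentiable, so its members are smooth in two
    variables; it contains the combinations of [n] and [N] with constant coefficients. *)
Inductive separable : (R -> R -> V) -> Prop :=
| separable_term (F : R -> R -> V) (p q : R -> R) (x : V) : smooth_on I p -> smooth_on J q ->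
    (forall u v, I u -> J v -> F u v = (p u * q v) *: x) -> separable F
| separable_add (F G H : R -> R -> V) : separable G -> separable H ->
    (forall u v, I u -> J v -> F u v = G u v + H u v) -> separable F.

Hypotheses (oI : open I) (oJ : open J).

Lemma separable_du F : separable F -> separable (du F) /\
  forall u v, I u -> J v -> is_derive u 1 (F ^~ v) (du F u v).
Proof.
elim=> {}F => [p q x ps qs FE|G H sG [sG' dG] sH [sH' dH] FE].
  have dF u v : I u -> J v -> is_derive u 1 (F ^~ v) ((derive1 p u * q v) *: x).
    move=> Iu Jv; apply: (is_derive_eqfun_on oI (fun s Is => FE s v Is Jv) Iu).
    apply: is_derive_scalel; apply: (is_derive_eq
      (is_derive_mul (smooth_is_derive 0 _ ps Iu) (is_derive_cst (q v) u 1))).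
    by rewrite mulr0 addr0.
  split=> [|u v Iu Jv]; last by have [dd _] := dF u v Iu Jv; exact: is_derive_derive1 dd.
  apply: (separable_term _ (derive1 p) q x (smooth_derive ps) qs) => u v Iu Jv.
  exact/derive1_val/dF.
have dF u v : I u -> J v -> is_derive u 1 (F ^~ v) (du G u v + du H u v).
  move=> Iu Jv; apply: (is_derive_eqfun_on oI (fun s Is => FE s v Is Jv) Iu).
  by apply: is_derive_add; [exact: dG|exact: dH].
split=> [|u v Iu Jv]; last by have [dd _] := dF u v Iu Jv; exact: is_derive_derive1 dd.
apply: separable_add sG' sH' _ => u v Iu Jv; exact/derive1_val/dF.
Qed.

Lemma separable_dv F : separable F -> separable (dv F) /\
  forall u v, I u -> J v -> is_derive v 1 (F u) (dv F u v).
Proof.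
elim=> {}F => [p q x ps qs FE|G H sG [sG' dG] sH [sH' dH] FE].
  have dF u v : I u -> J v -> is_derive v 1 (F u) ((p u * derive1 q v) *: x).
    move=> Iu Jv; apply: (is_derive_eqfun_on oJ (fun s Js => FE u s Iu Js) Jv).
    apply: is_derive_scalel; apply: (is_derive_eq
      (is_derive_mul (is_derive_cst (p u) v 1) (smooth_is_derive 0 _ qs Jv))).
    by rewrite mul0r add0r.
  split=> [|u v Iu Jv]; last by have [dd _] := dF u v Iu Jv; exact: is_derive_derive1 dd.
  apply: (separable_term _ p (derive1 q) x ps (smooth_derive qs)) => u v Iu Jv.
  exact/derive1_val/dF.
have dF u v : I u -> J v -> is_derive v 1 (F u) (dv G u v + dv H u v).
  move=> Iu Jv; apply: (is_derive_eqfun_on oJ (fun s Js => FE u s Iu Js) Jv).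
  by apply: is_derive_add; [exact: dG|exact: dH].
split=> [|u v Iu Jv]; last by have [dd _] := dF u v Iu Jv; exact: is_derive_derive1 dd.
apply: separable_add sG' sH' _ => u v Iu Jv; exact/derive1_val/dF.
Qed.

Lemma separable_differentiable F u v : separable F -> I u -> J v ->
  differentiable (fun p : R * R => F p.1 p.2) (u, v).
Proof.
move=> sF Iu Jv.
have nIJ : nbhs (u, v) [set p : R * R | I p.1 /\ J p.2].
  exists (I, J) => /=; last by [].
  by split; exact: open_nbhs_nbhs.
elim: sF => {}F => [p q x ps qs FE|G H sG dG sH dH FE].
  apply: (@near_eq_differentiable _ _ _ _ (fun z : R * R => (p z.1 * q z.2) *: x)).
    by apply: filterS nIJ => -[s t] [Is Jt]; exact: FE.
  apply: differentiableZl; apply: differentiableM.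
    apply: (@differentiable_comp _ _ _ _ fst p); first exact: differentiable_fst.
    exact/derivable1_diffP/(ps 0).
  apply: (@differentiable_comp _ _ _ _ snd q); first exact: differentiable_snd.
  exact/derivable1_diffP/(qs 0).
apply: near_eq_differentiable (differentiableD dG dH).
by apply: filterS nIJ => -[s t] [Is Jt]; exact: FE.
Qed.

Lemma separable_smooth2 F : separable F -> smooth2_on I J F.
Proof.
move=> sF s u v Iu Jv; apply: separable_differentiable => //.
elim: s => //= -[] s IHs; first by have [] := separable_du _ IHs.
by have [] := separable_dv _ IHs.
Qed.

End Separable.

Lemma separable_scale {R : realType} {I J : set R} {p : R -> R} {X : R -> 'rV[R]_4} :
  open J -> smooth_on I p -> smooth_on J X ->
  separable I J (fun u v => p u *: X v).
Proof.
move=> oJ ps /(smooth_on_coordP oJ) Xs.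
pose T i (u v : R) : 'rV[R]_4 := (p u * X v 0 i) *: 'e_i.
have sT i : separable I J (T i) by exact: separable_term ps (Xs i) _.
have E u v : p u *: X v = T 0 u v + (T 1 u v + (T 2%:R u v + T 3%:R u v)).
  rewrite [in LHS](row_sum_delta (X v)) scaler_sumr !big_ord_recl big_ord0 addr0 /T.
  rewrite !scalerA; congr (_ + (_ + (_ + _))); congr (_ * X v 0 _ *: delta_mx 0 _);
  exact/val_inj.
have E1 u v : I u -> J v -> p u *: X v = T 0 u v + (T 1 u v + (T 2%:R u v + T 3%:R u v)).
  by move=> _ _; exact: E.
apply: separable_add (sT 0) _ E1.
apply: (separable_add _ _ _ (T 1) (fun u v => T 2%:R u v + T 3%:R u v)) => //.
by apply: (separable_add _ _ _ (T 2%:R) (T 3%:R)).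
Qed.

(** * The differential equation of the meridian *)

Lemma continuous_sign {R : realType} {A : set R} {h : R -> R} : is_interval A ->
  (forall u, A u -> {for u, continuous h}) -> (forall u, A u -> h u != 0) ->
  exists2 s : R, s = 1 \/ s = -1 & forall u, A u -> h u = s * `|h u|.
Proof.
move=> itA hc h0; have [H|H] := nonvanishing_sign itA hc h0.
  by exists 1; [left|move=> u /H /gtr0_norm ->; rewrite mul1r].
by exists (-1); [right|move=> u /H /ltr0_norm ->; rewrite mulN1r opprK].
Qed.

Lemma asin_affine_derive {R : realType} {a b u : R} : (u - a) ^+ 2 < b ->
  is_derive u 1 (fun s : R => Num.sqrt b * asin ((s - a) / Num.sqrt b))
    (Num.sqrt b / Num.sqrt (b - (u - a) ^+ 2)).
Proof.
move=> ub; have b0 : 0 < b by apply: le_lt_trans ub; exact: sqr_ge0.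
pose r := Num.sqrt b; have r0 : 0 < r by rewrite sqrtr_gt0.
have r2 : r ^+ 2 = b by rewrite sqr_sqrtr // ltW.
have inr : -1 < (u - a) / r < 1.
  rewrite -ltr_norml -(ltr_pXn2r (n := 2)) ?nnegrE ?normr_ge0 ?ler01 //.
  by rewrite real_normK ?num_real // expr1n expr_div_n r2 ltr_pdivrMr // mul1r.
have di : is_derive u 1 (fun s : R => (s - a) / r) r^-1.
  by apply: is_derive_eq; rewrite /GRing.scale /=; ring.
have dc := @is_derive1_comp _ asin (fun s => (s - a) / r) u _ _ (is_derive1_asin inr) di.
apply: is_derive_eq (is_derive_scaler r dc) _.
have -> : 1 - ((u - a) / r) ^+ 2 = (b - (u - a) ^+ 2) / r ^+ 2.
  by rewrite -r2; field; rewrite gt_eqF.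
rewrite sqrtrM ?subr_ge0 ?ltW // sqrtrV ?sqr_ge0 // sqrtr_sqr (gtr0_norm r0).
rewrite /GRing.scale /= -/r; field.
by rewrite !gt_eqF // sqrtr_gt0 subr_gt0.
Qed.

Section Meridian.
Context {R : realType} {I : set R} {f g : R -> R}.
Hypothesis hM : meridian_curve I f g.

Local Notation f1 := (derive1 f).
Local Notation f2 := (derive1 (derive1 f)).
Local Notation g1 := (derive1 g).
Local Notation g2 := (derive1 (derive1 g)).

(** This is the function [Q] that governs the component of the mean curvature vector
    on [N]; see [meridian_mean_curvature]. *)
Definition meridian_factor (h k : R -> R) (u : R) : R :=
  h u * (derive1 (derive1 h) u * derive1 k u
         - derive1 (derive1 k) u * derive1 h u) + derive1 k u.

Definition constant_on (A : set R) (h : R -> R) : Prop :=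
  forall s t, A s -> A t -> h s = h t.

Local Notation Q := (meridian_factor f g).

Let oI : open I. Proof. by case: hM => -[]. Qed.
Let itI : is_interval I. Proof. by case: hM => -[]. Qed.
Let df u : I u -> is_derive u 1 f (f1 u).
Proof. by case: hM => _ fs _ _ _; exact: (smooth_is_derive 0 _ fs). Qed.
Let df1 u : I u -> is_derive u 1 f1 (f2 u).
Proof. by case: hM => _ fs _ _ _; exact: (smooth_is_derive 1 _ fs). Qed.
Let df2 u : I u -> is_derive u 1 f2 (derive1 f2 u).
Proof. by case: hM => _ fs _ _ _; exact: (smooth_is_derive 2 _ fs). Qed.
Let dg u : I u -> is_derive u 1 g (g1 u).
Proof. by case: hM => _ _ gs _ _; exact: (smooth_is_derive 0 _ gs). Qed.
Let dg1 u : I u -> is_derive u 1 g1 (g2 u).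
Proof. by case: hM => _ _ gs _ _; exact: (smooth_is_derive 1 _ gs). Qed.
Let dg2 u : I u -> is_derive u 1 g2 (derive1 g2 u).
Proof. by case: hM => _ _ gs _ _; exact: (smooth_is_derive 2 _ gs). Qed.
Let fN0 u : I u -> f u != 0.
Proof. by case: hM => _ _ _ h _ Iu; apply/eqP; exact: h. Qed.
Let speed u : I u -> g1 u ^+ 2 = f1 u ^+ 2 + 1.
Proof. by case: hM => _ _ _ _ h /h; lra. Qed.

Lemma meridian_g1_neq0 u : I u -> g1 u != 0.
Proof.
move=> /speed e; rewrite -sqrf_eq0 e; have := sqr_ge0 (f1 u); lra.
Qed.

Lemma meridian_speed_derive u : I u -> g1 u * g2 u = f1 u * f2 u.
Proof.
move=> Iu; have a := is_derive_sqr (dg1 _ Iu).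
have b := is_derive_eqfun_on oI speed Iu
  (is_derive_add (is_derive_sqr (df1 _ Iu)) (is_derive_cst (1 : R) u 1)).
move: (derive1_val a); rewrite (derive1_val b).
move: (f1 u) (f2 u) (g1 u) (g2 u) => x1 x2 y1 y2; lra.
Qed.

Lemma meridian_factor_g1 u : I u -> Q u * g1 u = f u * f2 u + f1 u ^+ 2 + 1.
Proof.
move=> Iu; move: (meridian_speed_derive _ Iu) (speed _ Iu); rewrite /meridian_factor.
move: (f u) (f1 u) (f2 u) (g1 u) (g2 u) => x x1 x2 y1 y2 a b.
transitivity (x * x2 * y1 ^+ 2 - x * x1 * (y1 * y2) + y1 ^+ 2); first by ring.
by rewrite a b; ring.
Qed.

Lemma meridian_factor_f1 u : I u -> Q u * f1 u = f1 u * g1 u + f u * g2 u.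
Proof.
move=> Iu; move: (meridian_speed_derive _ Iu) (speed _ Iu); rewrite /meridian_factor.
move: (f u) (f1 u) (f2 u) (g1 u) (g2 u) => x x1 x2 y1 y2 a b.
transitivity (x * y1 * (x1 * x2) - x * y2 * x1 ^+ 2 + x1 * y1); first by ring.
by rewrite -a (_ : x1 ^+ 2 = y1 ^+ 2 - 1); [ring|rewrite b; ring].
Qed.

Lemma is_derive_f_g1 u : I u -> is_derive u 1 (fun s => f s * g1 s) (Q u * f1 u).
Proof.
move=> Iu; rewrite meridian_factor_f1 //; exact: is_derive_mul (df _ Iu) (dg1 _ Iu).
Qed.

Lemma meridian_factor_derivable u : I u -> derivable Q u 1.
Proof.
move=> Iu; pose N s := -1 *: (g2 s * f1 s).
have dN := is_derive_scaler (-1 : R) (is_derive_mul (dg2 _ Iu) (df1 _ Iu)).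
rewrite (_ : Q = (fun s => f s * (f2 s * g1 s + N s) + g1 s)).
  by have [] := is_derive_add (is_derive_mul (df _ Iu)
    (is_derive_add (is_derive_mul (df2 _ Iu) (dg1 _ Iu)) dN)) (dg1 _ Iu).
by apply/funext => s; rewrite /N scaleN1r.
Qed.

Lemma constant_f_f1 : constant_on I f -> forall u, I u -> f1 u = 0.
Proof.
move=> fc u Iu; apply: derive1_val.
have fE s : I s -> f s = cst (f u) s by move=> Is; exact: fc.
exact: (is_derive_eqfun_on oI fE Iu (is_derive_cst _ _ _)).
Qed.

Lemma f1_eq0_constant : (forall u, I u -> f1 u = 0) -> constant_on I f.
Proof.
move=> f10; apply: zero_derive_constant _ itI _ => t It.
by rewrite -(f10 _ It); exact: df.
Qed.

(** A constant [f] forces [g'^2 = 1]; in particular [f] is not constant in case (i). *)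
Lemma constant_f_factor : constant_on I f -> forall u, I u -> Q u = g1 u /\ Q u != 0.
Proof.
move=> fc u Iu; have f10 := constant_f_f1 fc.
have f20 : f2 u = 0.
  apply: derive1_val.
  exact: (is_derive_eqfun_on oI (g := cst 0) f10 Iu (is_derive_cst (0 : R) _ _)).
rewrite /meridian_factor f20 f10 // !(mul0r, mulr0) subr0 mulr0 add0r.
by split=> //; exact: meridian_g1_neq0.
Qed.

Lemma f_sign : exists2 s : R, s = 1 \/ s = -1 & forall u, I u -> f u = s * `|f u|.
Proof.
have cf u : I u -> {for u, continuous f} by move=> Iu; exact: is_derive_continuous (df _ Iu).
exact: continuous_sign itI cf fN0.
Qed.

Lemma g1_sign : exists2 s : R, s = 1 \/ s = -1 & forall u, I u ->
  g1 u = s * Num.sqrt (f1 u ^+ 2 + 1).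
Proof.
have [|s s1 H] := continuous_sign (h := g1) itI _ meridian_g1_neq0.
  by move=> u Iu; exact: is_derive_continuous (dg1 _ Iu).
by exists s => // u Iu; rewrite -speed // sqrtr_sqr; exact: H.
Qed.

(** Here [Q g' = f f'' + f'^2 + 1] is half the second derivative of [f^2 + u^2]. *)
Lemma factor0_quadratic : (forall u, I u -> Q u = 0) <->
  exists a b, forall u, I u -> f u ^+ 2 = - u ^+ 2 + 2 * a * u + b.
Proof.
split=> [Q0|[a [b fE]] u Iu]; last first.
  have D1 s : I s -> 2 * f s * f1 s = - (2 * s) + 2 * a.
    move=> Is.
    have dr : is_derive s 1 (fun t : R => - t ^+ 2 + 2 * a * t + b) (- (2 * s) + 2 * a).
      apply: is_derive_eq.
      rewrite /GRing.scale /=; ring.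
    rewrite -(derive1_val (is_derive_eqfun_on oI fE Is dr)).
    by rewrite (derive1_val (is_derive_sqr (df _ Is))).
  have D2 : 2 * f1 u * f1 u + 2 * f u * f2 u = -2.
    have dl : is_derive u 1 (fun s => 2 * f s * f1 s) (2 * f1 u * f1 u + 2 * f u * f2 u).
      exact: is_derive_mul (is_derive_scaler (2 : R) (df _ Iu)) (df1 _ Iu).
    have dr : is_derive u 1 (fun t : R => - (2 * t) + 2 * a) (-2).
      apply: is_derive_eq.
      rewrite /GRing.scale /=; ring.
    by rewrite -(derive1_val dl) (derive1_val (is_derive_eqfun_on oI D1 Iu dr)).
  have := meridian_factor_g1 _ Iu.
  rewrite (_ : _ + 1 = 0); last by rewrite expr2; lra.
  by move/eqP; rewrite mulf_eq0 (negPf (meridian_g1_neq0 _ Iu)) orbF => /eqP.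
case: hM => -[_ _ [u0 Iu0]] _ _ _ _.
pose a := f u0 * f1 u0 + u0; pose b := f u0 ^+ 2 + u0 ^+ 2 - 2 * a * u0.
have D1 u : I u -> f u * f1 u + u = a.
  move=> Iu; apply: (zero_derive_constant (fun s => f s * f1 s + s) itI) Iu Iu0 => t It.
  apply: is_derive_eq
    (is_derive_add (is_derive_mul (df _ It) (df1 _ It)) (is_derive_id t (1 : R))) _.
  have := meridian_factor_g1 _ It; rewrite Q0 // mul0r; lra.
exists a, b => u Iu.
suff : f u ^+ 2 + u ^+ 2 - 2 * a * u = b by lra.
apply: (zero_derive_constant (fun s => f s ^+ 2 + s ^+ 2 - 2 * a * s) itI) Iu Iu0 => t It.
have dr : is_derive t 1 (fun t : R => t ^+ 2 - 2 * a * t) (2 * t - 2 * a).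
  by apply: is_derive_eq; rewrite /GRing.scale /=; ring.
under eq_fun do rewrite -addrA.
apply: is_derive_eq (is_derive_add (is_derive_sqr (df _ It)) dr) _.
by rewrite -(D1 _ It); lra.
Qed.

(** With [r^2 = a^2 + b] one has [f^2 = r^2 - (u - a)^2] and [f f' = a - u], hence
    [g'^2 = f'^2 + 1 = r^2 / f^2], the square of the derivative of
    [r arcsin ((u - a) / r)]. *)
Lemma case_i_of_factor0 (J : set R) (kappa : R -> R) :
  (forall v, J v -> kappa v <> 0) -> (forall u, I u -> Q u = 0) ->
  case_i I J f g kappa.
Proof.
move=> k0 /factor0_quadratic [a [b fE]]; split=> //.
have [s1 s1E fs] := f_sign; have [s2 s2E gs] := g1_sign.
have [u0 Iu0] : I !=set0 by case: hM => -[].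
have radE u : I u -> - u ^+ 2 + 2 * a * u + b = (a ^+ 2 + b) - (u - a) ^+ 2.
  by move=> _; ring.
have f2E u : I u -> f u ^+ 2 = (a ^+ 2 + b) - (u - a) ^+ 2 by move=> Iu; rewrite -radE ?fE.
have ltb u : I u -> (u - a) ^+ 2 < a ^+ 2 + b.
  by move=> Iu; rewrite -subr_gt0 -f2E // exprn_even_gt0 //= fN0.
have ff1 u : I u -> f u * f1 u = a - u.
  move=> Iu; have dr : is_derive u 1 (fun t : R => - t ^+ 2 + 2 * a * t + b) (- (2 * u) + 2 * a).
    by apply: is_derive_eq; rewrite /GRing.scale /=; ring.
  have := derive1_val (is_derive_eqfun_on oI fE Iu dr).
  rewrite (derive1_val (is_derive_sqr (df _ Iu))); lra.
have g1E u : I u -> g1 u = s2 * (Num.sqrt (a ^+ 2 + b) / Num.sqrt (a ^+ 2 + b - (u - a) ^+ 2)).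
  move=> Iu; rewrite gs //; congr (_ * _).
  have -> : f1 u ^+ 2 + 1 = (a ^+ 2 + b) / f u ^+ 2.
    have -> : a ^+ 2 + b = f u ^+ 2 + (f u * f1 u) ^+ 2 by rewrite f2E // ff1 //; ring.
    by field; exact: fN0.
  by rewrite sqrtrM ?(le_trans _ (ltW (ltb _ Iu))) ?sqr_ge0 // sqrtrV ?sqr_ge0 // f2E.
pose G u := s2 * (Num.sqrt (a ^+ 2 + b) * asin ((u - a) / Num.sqrt (a ^+ 2 + b))).
exists a, b, (g u0 - G u0), s1, s2; split=> // u Iu; split.
  by rewrite -fE // sqrtr_sqr; exact: fs.
rewrite -mulrA -/(G u).
suff : g u - G u = g u0 - G u0 by move=> <-; ring.
apply: (zero_derive_constant (fun s => g s - G s) itI) Iu Iu0 => t It.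
have dG := is_derive_scaler s2 (asin_affine_derive (ltb _ It)).
apply: is_derive_eq (is_deriveB (dg _ It) dG) _.
by rewrite g1E // subrr.
Qed.

Lemma factor0_of_case_i (J : set R) (kappa : R -> R) :
  case_i I J f g kappa -> forall u, I u -> Q u = 0.
Proof.
move=> [_ [a [b [c [s1 [s2 [s1E _ fg]]]]]]]; apply/factor0_quadratic.
exists a, b => u Iu; have [fE _] := fg _ Iu.
have := fN0 _ Iu; rewrite fE mulf_eq0 negb_or => /andP[_ r0].
have r1 : 0 < - u ^+ 2 + 2 * a * u + b by rewrite -sqrtr_gt0 lt_neqAle eq_sym r0 sqrtr_ge0.
by rewrite exprMn sqr_sqrtr ?ltW //; case: s1E => ->; rewrite ?sqrrN expr1n mul1r.
Qed.

(** A first integral of [f f'' + f'^2 + 1 = c g'], because [(f g')' = Q f'] and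
    [Q = c]. *)
Lemma factor_cst_first_integral c : (forall u, I u -> Q u = c) ->
  exists a, forall u, I u -> f u * g1 u = c * f u + a.
Proof.
move=> Qc; have [u0 Iu0] : I !=set0 by case: hM => -[].
exists (f u0 * g1 u0 - c * f u0) => u Iu.
suff : f u * g1 u - c * f u = f u0 * g1 u0 - c * f u0 by lra.
apply: (zero_derive_constant (fun s => f s * g1 s - c * f s) itI) Iu Iu0 => t It.
apply: is_derive_eq (is_deriveB (is_derive_f_g1 _ It) (is_derive_scaler c (df _ It))) _.
by rewrite Qc // /GRing.scale /= subrr.
Qed.

(** Both sides of [Q u = rho * kappa v] are constant, equal to [c = rho k]; squaring
    the first integral [f g' = c f + a] gives [(f f')^2 = (c f + a)^2 - f^2]. *)
Lemma case_ii_of_factor (J : set R) (kappa : R -> R) rho :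
  J !=set0 -> (forall v, J v -> kappa v <> 0) ->
  rho != 0 -> rho ^+ 2 <> 1 -> (forall u v, I u -> J v -> Q u = rho * kappa v) ->
  ~ constant_on I f -> case_ii I J f g kappa.
Proof.
move=> [v0 Jv0] k0 r0 r1 Qk fnc.
have [u0 Iu0] : I !=set0 by case: hM => -[].
pose k := kappa v0; pose c := rho * k.
have kN0 : k != 0 by apply/eqP; exact: k0.
have [a fga] : exists a, forall u, I u -> f u * g1 u = c * f u + a.
  by apply: factor_cst_first_integral => u Iu; rewrite (Qk _ v0).
have rad u : I u -> radicand a c (f u) = (f u * f1 u) ^+ 2.
  by move=> Iu; rewrite /radicand -fga // exprMn speed //; ring.
exists k, a, c; split.
- split; first exact/eqP.
  by move=> v Jv; apply: (mulfI r0); rewrite -(Qk u0) // -(Qk u0).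
- split; first by apply/eqP; rewrite mulf_neq0.
  rewrite /c exprMn => /eqP; rewrite -subr_eq0 -{2}(mul1r (k ^+ 2)) -mulrBl.
  by rewrite mulf_eq0 sqrf_eq0 (negPf kN0) orbF subr_eq0 => /eqP.
- move=> u Iu; rewrite /phi rad // sqr_ge0 sqrtr_sqr; split=> //.
  have fN := fN0 _ Iu.
  have [h|h] := leP 0 (f u * f1 u); [left|right].
    by rewrite ger0_norm //; field.
  by rewrite ltr0_norm //; field.
- apply: contrapT => no; apply: fnc => s t Is It; apply: contrapT => fst.
  by apply: no; exists s, t.
- by have [s s1 gs] := g1_sign; exists s.
Qed.

(** Squaring the equation gives [f g' = sg (c f + a)] with a constant sign [sg], and
    differentiation gives [(Q - sg c) f' = 0]. A solution could a priori be stationary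
    on a subinterval; there [Q = g'] is the constant sign of [g'], so [Q] takes at most
    two values on [I] and is constant. If it is not [sg c], then [f] is constant. *)
Lemma factor_of_case_ii (J : set R) (kappa : R -> R) :
  case_ii I J f g kappa ->
  exists2 rho, rho ^+ 2 <> 1 & forall u v, I u -> J v -> Q u = rho * kappa v.
Proof.
move=> [k [a [c [[k0 kk] [c0 ck] ode [u1 [u2 [Iu1 Iu2 f12]]] _]]]].
have fnc : ~ constant_on I f by move=> fc; apply: f12; exact: fc.
have fg2 u : I u -> (f u * g1 u) ^+ 2 = (c * f u + a) ^+ 2.
  move=> Iu; have [rad0 fp] := ode _ Iu.
  have fN := fN0 _ Iu.
  have ff1 : (f u * f1 u) ^+ 2 = radicand a c (f u).
    by rewrite -[RHS](sqr_sqrtr rad0); case: fp => ->; rewrite /phi; field.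
  by rewrite exprMn speed // mulrDr mulr1 -exprMn ff1 /radicand; ring.
have fgN u : I u -> f u * g1 u != 0.
  by move=> Iu; rewrite mulf_neq0 ?fN0 ?meridian_g1_neq0.
(* The quotient of [f g'] by [c f + a] is continuous with values in {1, -1}. *)
have [sg sg1 fgE] : exists2 s : R, s = 1 \/ s = -1 &
    forall u, I u -> f u * g1 u = s * (c * f u + a).
  have lN u : I u -> c * f u + a != 0 by move=> Iu; rewrite -sqrf_eq0 -fg2 // sqrf_eq0 fgN.
  have rE u : I u -> f u * g1 u / (c * f u + a) = 1 \/ f u * g1 u / (c * f u + a) = -1.
    move=> Iu; have /eqP := fg2 _ Iu; rewrite eqf_sqr => /orP[] /eqP ->; [left|right].
      by rewrite divff ?lN.
    by rewrite mulNr divff ?lN.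
  have [|r1|r1] := two_valued_constant itI _ rE.
  - move=> u Iu; apply: cvgM; first exact: is_derive_continuous (is_derive_f_g1 _ Iu).
    apply: cvgV; first exact: lN.
    apply: cvgD; last exact: cvg_cst.
    exact: is_derive_continuous (is_derive_scaler c (df _ Iu)).
  - by exists 1; [left|move=> u Iu; rewrite -(r1 _ Iu) divfK ?lN].
  - by exists (-1); [right|move=> u Iu; rewrite -(r1 _ Iu) divfK ?lN].
have Qf1 u : I u -> Q u * f1 u = sg * c * f1 u.
  move=> Iu; rewrite -(derive1_val (is_derive_f_g1 _ Iu)).
  have dr := is_derive_scaler sg (is_derive_add
     (is_derive_scaler c (df _ Iu)) (is_derive_cst (a : R) u 1)).
  rewrite (derive1_val (is_derive_eqfun_on oI fgE Iu dr)).
  by rewrite /GRing.scale /= addr0 mulrA.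
have [s s1 gs] := g1_sign.
have Q2 u : I u -> Q u = sg * c \/ Q u = s.
  move=> Iu; have [->|Qu] := eqVneq (Q u) (sg * c); [by left|right].
  have nz : \forall t \near u, f1 t = cst 0 t.
    have [dQ _] := is_derive_derive1 (meridian_factor_derivable _ Iu).
    have cQ : {for u, continuous Q} by exact: is_derive_continuous (is_derive_derive1 dQ).
    have nQ : \forall t \near u, Q t != sg * c.
      exact: cQ (open_nbhs_nbhs (conj (@open_neq _ (sg * c)) Qu)).
    apply: filterS2 nQ (open_nbhs_nbhs (conj oI Iu)) => t Qt It.
    have /eqP := Qf1 _ It; rewrite -subr_eq0 -mulrBl mulf_eq0 subr_eq0 (negPf Qt).
    by move=> /eqP.
  have f10 : f1 u = 0 by exact: nbhs_singleton nz.
  have f20 : f2 u = 0 by rewrite derive1E (near_eq_derive _ nz) derive_cst.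
  by rewrite /meridian_factor f20 f10 gs // f10 expr0n add0r sqrtr1; ring.
have QE u : I u -> Q u = sg * c.
  have [|Qc|Qs] := two_valued_constant itI _ Q2; last 2 first.
  - exact: Qc.
  - move=> Iu; rewrite Qs //; apply: contrapT => scs; apply: fnc.
    apply: f1_eq0_constant => t It; have := Qf1 _ It; rewrite Qs // => /eqP.
    by rewrite -subr_eq0 -mulrBl mulf_eq0 subr_eq0 => /orP[/eqP/scs//|/eqP].
  - move=> t It; have [dQ _] := is_derive_derive1 (meridian_factor_derivable _ It).
    exact: is_derive_continuous (is_derive_derive1 dQ).
exists (sg * c / k).
  move=> r1; apply: ck; rewrite -[RHS]mul1r -r1.
  by case: sg1 => ->; field; exact/eqP.
by move=> u v Iu Jv; rewrite QE // kk // divfK //; exact/eqP.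
Qed.

(** The part of the theorem that involves only [f], [g] and the function [kappa]: the
    geometry enters through the left-hand side. *)
Lemma meridian_classification (J : set R) (kappa : R -> R) :
  J !=set0 -> (forall v, J v -> kappa v <> 0) ->
  ((exists2 rho, rho ^+ 2 <> 1 & forall u v, I u -> J v -> Q u = rho * kappa v)
    /\ ~ constant_on I f)
  <-> (case_i I J f g kappa \/ case_ii I J f g kappa).
Proof.
move=> J0 k0; have [u0 Iu0] : I !=set0 by case: hM => -[].
split=> [[[rho r1 Qk] fnc]|].
  have [r0|r0] := eqVneq rho 0; last by right; exact: case_ii_of_factor r0 r1 Qk fnc.
  left; apply: case_i_of_factor0 => // u Iu.
  by case: J0 => v Jv; rewrite (Qk _ v) // r0 mul0r.
case=> [/factor0_of_case_i Q0|ii].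
  split; last by move=> /constant_f_factor /(_ _ Iu0) [_]; rewrite Q0 // eqxx.
  by exists 0 => [|u v Iu _]; rewrite ?mul0r ?Q0 // expr0n /= => /esym/eqP; rewrite oner_eq0.
split; first exact: factor_of_case_ii ii.
by case: ii => k [a [c [_ _ _ [u1 [u2 [Iu1 Iu2 f12]]] _]]] fc; apply: f12; exact: fc.
Qed.

End Meridian.

(** * Orthonormal frames of the neutral space *)

Section Sprod.
Context {R : realType}.
Implicit Types x y w : 'rV[R]_4.

Lemma sprodE x y : sprod x y = x 0 0 * y 0 0 + x 0 1 * y 0 1
  - x 0 2%:R * y 0 2%:R - x 0 3%:R * y 0 3%:R.
Proof.
have i1 : lift ord0 ord0 = 1 :> 'I_4 by exact/val_inj.
have i2 : lift ord0 (lift ord0 ord0) = 2%:R :> 'I_4 by exact/val_inj.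
have i3 : lift ord0 (lift ord0 (lift ord0 ord0)) = 3%:R :> 'I_4 by exact/val_inj.
by rewrite /sprod !big_ord_recl big_ord0 /= i3 i2 i1; ring.
Qed.

Lemma sprodC x y : sprod x y = sprod y x.
Proof. by rewrite !sprodE; ring. Qed.

Lemma sprodDl x y w : sprod (x + y) w = sprod x w + sprod y w.
Proof. by rewrite !sprodE !mxE; ring. Qed.

Lemma sprodZl a x w : sprod (a *: x) w = a * sprod x w.
Proof. by rewrite !sprodE !mxE; ring. Qed.

Lemma sprodDr x y w : sprod w (x + y) = sprod w x + sprod w y.
Proof. by rewrite !(sprodC w) sprodDl. Qed.

Lemma sprodZr a x w : sprod w (a *: x) = a * sprod w x.
Proof. by rewrite !(sprodC w) sprodZl. Qed.

Lemma sprod0l x : sprod 0 x = 0.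
Proof. by rewrite -(scale0r 0) sprodZl mul0r. Qed.

Definition sprodL := (sprodDl, sprodDr, sprodZl, sprodZr).

(** The matrix [M] with rows [m i] satisfies [M G M^T = D], where [G] is the matrix of
    the metric and [D] is diagonal with entries [d i]. Taking determinants, [det D] is
    [(det M)^2]. Moreover [G M^T D] is a right inverse of the square matrix [M],
    hence a left inverse, and this is the expansion of a vector in the basis. *)
Lemma orthonormal4 (m : 'I_4 -> 'rV[R]_4) (d : 'I_4 -> R) :
  (forall i, d i ^+ 2 = 1) ->
  (forall i j, sprod (m i) (m j) = d i *+ (i == j)) ->
  0 < \prod_i d i /\ forall w, w = \sum_i (d i * sprod w (m i)) *: m i.
Proof.
move=> d2 md.
pose G : 'M[R]_4 := diag_mx (\row_i (if (i < 2)%N then 1 else -1)).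
pose M : 'M[R]_4 := \matrix_(i, j) m i 0 j.
pose D : 'M[R]_4 := diag_mx (\row_i d i).
have sE x y : sprod x y = (x *m G *m y^T) 0 0.
  by rewrite mul_mx_diag !mxE; apply: eq_bigr => i _; rewrite !mxE; ring.
have rM i : row i M = m i by apply/rowP => j; rewrite !mxE.
have MGM : M *m G *m M^T = D.
  apply/matrixP => i j; rewrite [RHS]mxE [(\row_i _) _ _]mxE -md sE -!rM.
  by rewrite !mxE; apply: eq_bigr => k _; rewrite !mul_mx_diag !mxE.
have detG : \det G = 1.
  by rewrite det_diag !big_ord_recl big_ord0 !mxE /=; ring.
have detD : \det D = \prod_i d i by rewrite det_diag; apply: eq_bigr => i _; rewrite mxE.
have DD : D *m D = 1%:M.
  apply/matrixP => i j; rewrite mul_mx_diag !mxE.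
  by case: eqVneq => [->|]; rewrite ?mul0r // mulr1n -expr2 d2.
split.
  have d0 : \det M ^+ 2 = \prod_i d i.
    by rewrite -detD -MGM !det_mulmx det_tr detG mulr1.
  rewrite -d0 exprn_even_gt0 //= -sqrf_eq0 d0 prodf_seq_neq0; apply/allP => i _ /=.
  by rewrite -sqrf_eq0 d2 oner_eq0.
move=> w; have MI : M *m (G *m M^T *m D) = 1%:M by rewrite !mulmxA MGM.
rewrite -[LHS]mulmx1 -(mulmx1C MI) !mulmxA (mulmx_sum_row _ M).
apply: eq_bigr => i _; rewrite rM; congr (_ *: _).
rewrite mul_mx_diag [LHS]mxE [(\row_i _) _ _]mxE mulrC sE -rM; congr (_ * _).
by rewrite !mxE; apply: eq_bigr => k _; rewrite !mxE.
Qed.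

End Sprod.

Section Frame.
Context {R : realType}.
Implicit Types x y w : 'rV[R]_4.

Definition meridian_frame (eta : R) (l t n e0 : 'rV[R]_4) : Prop :=
  [/\ sprod l l = eta, sprod t t = eta, sprod n n = - eta & sprod e0 e0 = - eta] /\
  [/\ sprod l t = 0, sprod l n = 0 & sprod t n = 0] /\
  [/\ sprod l e0 = 0, sprod t e0 = 0 & sprod n e0 = 0].

(** The sign of [n] is forced, since the product of the four signs is positive. *)
Lemma meridian_frameP {eta : R} {l t n e0} : eta = 1 \/ eta = -1 ->
  [/\ sprod l l = eta, sprod t t = eta, unitv n & sprod e0 e0 = - eta] ->
  [/\ sprod l t = 0, sprod l n = 0 & sprod t n = 0] ->
  [/\ sprod l e0 = 0, sprod t e0 = 0 & sprod n e0 = 0] ->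
  meridian_frame eta l t n e0 /\
  forall w, w = (eta * sprod w l) *: l + (eta * sprod w t) *: t
    - (eta * sprod w n) *: n - (eta * sprod w e0) *: e0.
Proof.
move=> eta1 [ll tt nU ee] [lt ln tn] [le te ne].
pose m (i : 'I_4) := nth (0 : 'rV[R]_4) [:: l; t; n; e0] i.
pose d (i : 'I_4) := nth 0 [:: eta; eta; sprod n n; - eta] i.
have e2 : eta ^+ 2 = 1 by case: eta1 => ->; rewrite ?sqrrN expr1n.
have n2 : sprod n n ^+ 2 = 1 by case: nU => ->; rewrite ?sqrrN expr1n.
have d2 i : d i ^+ 2 = 1.
  by case: i => -[|[|[|[|//]]]] ? /=; rewrite /d /= ?sqrrN.
have md i j : sprod (m i) (m j) = d i *+ (i == j).
  case: i => -[|[|[|[|//]]]] ?; case: j => -[|[|[|[|//]]]] ?;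
  by rewrite /m /d /= ?mulr1n ?mulr0n // sprodC.
have [] := orthonormal4 m d d2 md; rewrite !big_ord_recl big_ord0 /d /m /= => dpos ex.
have nn : sprod n n = - eta.
  case: eta1 nU dpos => -> [] ->;
  by rewrite ?(mulr1, mul1r, mulrN, mulNr, opprK, ltrN10, ltr0N1) //; lra.
split; first by [].
move=> w; rewrite {1}(ex w) !big_ord_recl big_ord0 /d /m /= nn addr0 !mulNr !scaleNr.
by rewrite !addrA.
Qed.

(** All sixteen products as one rewriting rule. *)
Lemma meridian_frameE {eta : R} {l t n e0} : meridian_frame eta l t n e0 ->
  ((sprod l l = eta) * (sprod t t = eta) * (sprod n n = - eta) * (sprod e0 e0 = - eta)
  * (sprod l t = 0) * (sprod l n = 0) * (sprod l e0 = 0) * (sprod t l = 0)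
  * (sprod t n = 0) * (sprod t e0 = 0) * (sprod n l = 0) * (sprod n t = 0)
  * (sprod n e0 = 0) * (sprod e0 l = 0) * (sprod e0 t = 0) * (sprod e0 n = 0))%type.
Proof.
move=> [[ll tt nn ee] [[lt ln tn] [le te ne]]].
by do !split=> //; rewrite sprodC.
Qed.

End Frame.

(** * Geometry of a meridian surface *)

Section MeridianSurface.
Context {R : realType} {I J : set R} {f g : R -> R} {eta : R}.
Context {e0 : 'rV[R]_4} {l n : R -> 'rV[R]_4}.
Hypothesis hM : meridian_curve I f g.
Hypothesis hJ : open_interval J.
Hypothesis eta1 : eta = 1 \/ eta = -1.
Hypotheses (ls : smooth_on J l) (ns : smooth_on J n).
Hypothesis frame : forall v, J v -> meridian_frame eta (l v) (derive1 l v) (n v) e0 /\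
  forall w, w = (eta * sprod w (l v)) *: l v + (eta * sprod w (derive1 l v)) *: derive1 l v
    - (eta * sprod w (n v)) *: n v - (eta * sprod w e0) *: e0.

Local Notation f1 := (derive1 f).
Local Notation f2 := (derive1 (derive1 f)).
Local Notation g1 := (derive1 g).
Local Notation g2 := (derive1 (derive1 g)).
Local Notation t := (derive1 l).
Local Notation Q := (meridian_factor f g).
Local Notation kappa := (spherical_curvature l n).

Definition meridian_surface (u v : R) : 'rV[R]_4 := f u *: l v + g u *: e0.
(** The unit normal field orthogonal to [n]; its square is [eta]. *)
Definition meridian_normal (u v : R) : 'rV[R]_4 := g1 u *: l v + f1 u *: e0.
Local Notation z := meridian_surface.
Local Notation N := meridian_normal.

Let oI : open I. Proof. by case: hM => -[]. Qed.
Let itI : is_interval I. Proof. by case: hM => -[]. Qed.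
Let oJ : open J. Proof. by case: hJ. Qed.
Let itJ : is_interval J. Proof. by case: hJ. Qed.
Let fs : smooth_on I f. Proof. by case: hM. Qed.
Let gs : smooth_on I g. Proof. by case: hM. Qed.
Let fN0 u : I u -> f u != 0.
Proof. by case: hM => _ _ _ h _ Iu; apply/eqP; exact: h. Qed.
Let speed u : I u -> g1 u ^+ 2 = f1 u ^+ 2 + 1.
Proof. by case: hM => _ _ _ _ h /h; lra. Qed.
Let df k u : I u -> is_derive u 1 (derive1n k f) (derive1n k.+1 f u).
Proof. exact: smooth_is_derive. Qed.
Let dg k u : I u -> is_derive u 1 (derive1n k g) (derive1n k.+1 g u).
Proof. exact: smooth_is_derive. Qed.
Let dl k v : J v -> is_derive v 1 (derive1n k l) (derive1n k.+1 l v).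
Proof. exact: smooth_is_derive. Qed.
Let dn v : J v -> is_derive v 1 n (derive1 n v).
Proof. exact: (smooth_is_derive 0 v ns). Qed.
Let eta2 : eta ^+ 2 = 1. Proof. by case: eta1 => ->; rewrite ?sqrrN expr1n. Qed.
Let etaN0 : eta != 0. Proof. by rewrite -sqrf_eq0 eta2 oner_eq0. Qed.

Lemma profile_du {a b : R -> R} {u a' b' : R} (x y : 'rV[R]_4) :
  is_derive u 1 a a' -> is_derive u 1 b b' ->
  is_derive u 1 (fun s => a s *: x + b s *: y) (a' *: x + b' *: y).
Proof. by move=> da db; apply: is_derive_add; exact: is_derive_scalel. Qed.

Lemma profile_dv {a : R} {X : R -> 'rV[R]_4} {v : R} {X'} (y : 'rV[R]_4) :
  is_derive v 1 X X' -> is_derive v 1 (fun s => a *: X s + y) (a *: X').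
Proof.
move=> dX; rewrite -[a *: X']addr0.
exact: is_derive_add (is_derive_scaler a dX) (is_derive_cst y v 1).
Qed.

Lemma meridian_du u v : I u -> du z u v = f1 u *: l v + g1 u *: e0.
Proof. by move=> Iu; apply: derive1_val; exact: (profile_du (l v) e0 (df 0 u Iu) (dg 0 u Iu)). Qed.

Lemma meridian_dv u v : J v -> dv z u v = f u *: t v.
Proof. by move=> Jv; apply: derive1_val; exact: (profile_dv (g u *: e0) (dl 0 v Jv)). Qed.

Lemma meridian_duu u v : I u -> du (du z) u v = f2 u *: l v + g2 u *: e0.
Proof.
move=> Iu; apply: derive1_val.
have E s : I s -> du z s v = f1 s *: l v + g1 s *: e0 by exact: meridian_du.
exact: is_derive_eqfun_on oI E Iu (profile_du _ _ (df 1 _ Iu) (dg 1 _ Iu)).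
Qed.

Lemma meridian_dvv u v : J v -> dv (dv z) u v = f u *: derive1 t v.
Proof.
move=> Jv; apply: derive1_val.
have E s : J s -> dv z u s = f u *: t s by exact: meridian_dv.
exact: is_derive_eqfun_on oJ E Jv (is_derive_scaler _ (dl 1 v Jv)).
Qed.

Lemma sprod_cst_derive {X Y : R -> 'rV[R]_4} {c v : R} {X' Y'} : J v ->
  (forall s, J s -> sprod (X s) (Y s) = c) ->
  is_derive v 1 X X' -> is_derive v 1 Y Y' -> sprod X' (Y v) = - sprod (X v) Y'.
Proof.
move=> Jv XYc dX dY.
have dc := is_derive_eqfun_on oJ (g := cst c) XYc Jv (is_derive_cst c v 1).
have := derive1_val (is_derive_sprod dX dY); rewrite (derive1_val dc) => /esym/eqP.
by rewrite addr_eq0 => /eqP.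
Qed.

(** The Frenet equations of [l]: the coefficients of [t'] and [n'] in the frame follow
    by differentiating the constant products of the frame. *)
Lemma frenet_t v : J v -> derive1 t v = - l v - (eta * kappa v) *: n v.
Proof.
move=> Jv; have [_ ex] := frame _ Jv.
have [[ll tt nn ee] [[lt ln tn] [le te ne]]] := (frame _ Jv).1.
have fr s : J s -> meridian_frame eta (l s) (t s) (n s) e0 by move=> /frame[].
have tl : sprod (derive1 t v) (l v) = - eta.
  have H s : J s -> sprod (t s) (l s) = 0 by move=> /fr[_ [[+ _ _] _]]; rewrite sprodC.
  by rewrite (sprod_cst_derive Jv H (dl 1 v Jv) (dl 0 v Jv)) tt.
have tt0 : sprod (derive1 t v) (t v) = 0.
  have H s : J s -> sprod (t s) (t s) = eta by move=> /fr[[]].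
  have := sprod_cst_derive Jv H (dl 1 v Jv) (dl 1 v Jv).
  by rewrite [X in _ = - X]sprodC; move: (sprod _ _) => x; lra.
have te0 : sprod (derive1 t v) e0 = 0.
  have H s : J s -> sprod (t s) (cst e0 s) = 0 by move=> /fr[_ [_ []]].
  rewrite (sprod_cst_derive Jv H (dl 1 v Jv) (is_derive_cst e0 v 1)).
  by rewrite sprodC sprod0l oppr0.
rewrite {1}(ex (derive1 t v)) tl tt0 te0 -/(kappa v) mulrN -expr2 eta2 !mulr0 !scale0r.
by rewrite addr0 subr0 scaleN1r.
Qed.

Lemma frenet_n v : J v -> derive1 n v = - (eta * kappa v) *: t v.
Proof.
move=> Jv; have [_ ex] := frame _ Jv.
have [[ll tt nn ee] [[lt ln tn] [le te ne]]] := (frame _ Jv).1.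
have fr s : J s -> meridian_frame eta (l s) (t s) (n s) e0 by move=> /frame[].
have dnv := dn v Jv.
have nl : sprod (derive1 n v) (l v) = 0.
  have H s : J s -> sprod (n s) (l s) = 0 by move=> /fr[_ [[_ + _] _]]; rewrite sprodC.
  by rewrite (sprod_cst_derive Jv H dnv (dl 0 v Jv)) sprodC tn oppr0.
have nt : sprod (derive1 n v) (t v) = - kappa v.
  have H s : J s -> sprod (n s) (t s) = 0 by move=> /fr[_ [[_ _ +] _]]; rewrite sprodC.
  by rewrite (sprod_cst_derive Jv H dnv (dl 1 v Jv)) sprodC.
have nn0 : sprod (derive1 n v) (n v) = 0.
  have H s : J s -> sprod (n s) (n s) = - eta by move=> /fr[[]].
  have := sprod_cst_derive Jv H dnv dnv.
  by rewrite [X in _ = - X]sprodC; move: (sprod _ _) => x; lra.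
have ne0 : sprod (derive1 n v) e0 = 0.
  have H s : J s -> sprod (n s) (cst e0 s) = 0 by move=> /fr[_ [_ []]].
  rewrite (sprod_cst_derive Jv H dnv (is_derive_cst e0 v 1)).
  by rewrite sprodC sprod0l oppr0.
rewrite {1}(ex (derive1 n v)) nl nt nn0 ne0 !mulr0 !scale0r.
by rewrite !subr0 add0r mulrN.
Qed.

Let frE v (Jv : J v) := meridian_frameE (frame v Jv).1.

(** Products in the plane spanned by [l v] and [e0], where [z_u] and [N] live. *)
Lemma plane_sprod v (a b c d : R) : J v ->
  sprod (a *: l v + b *: e0) (c *: l v + d *: e0) = eta * (a * c - b * d).
Proof. by move=> Jv; rewrite !sprodL !(frE v Jv); ring. Qed.

Lemma plane_sprod_n v (a b : R) : J v -> sprod (a *: l v + b *: e0) (n v) = 0.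
Proof. by move=> Jv; rewrite !sprodL !(frE v Jv); ring. Qed.

Lemma plane_sprod_t v (a b : R) : J v -> sprod (a *: l v + b *: e0) (t v) = 0.
Proof. by move=> Jv; rewrite !sprodL !(frE v Jv); ring. Qed.

Lemma first_form u v : I u -> J v ->
  (ffE z u v = - eta) * (ffF z u v = 0) * (ffG z u v = eta * f u ^+ 2)
  * (ffW z u v = - f u ^+ 2).
Proof.
move=> Iu Jv; have E : ffE z u v = - eta.
  rewrite /ffE (meridian_du _ _ Iu) (plane_sprod _ _ _ _ _ Jv) -!expr2 (speed _ Iu).
  by rewrite opprD addrA subrr add0r mulrN1.
have F : ffF z u v = 0.
  rewrite /ffF (meridian_du _ _ Iu) (meridian_dv _ _ Jv) sprodZr (plane_sprod_t _ _ _ Jv).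
  by rewrite mulr0.
have G : ffG z u v = eta * f u ^+ 2.
  rewrite /ffG (meridian_dv _ _ Jv) sprodZl sprodZr (frE v Jv).
  by move: (f u) => x; ring.
do !split; rewrite ?E ?F ?G // /ffW E F G; move: (f u) => x.
by transitivity (- (eta ^+ 2 * x ^+ 2)); [ring|rewrite eta2 mul1r].
Qed.

Lemma normal_norm u v : I u -> J v -> sprod (N u v) (N u v) = eta.
Proof.
move=> Iu Jv; rewrite (plane_sprod _ _ _ _ _ Jv) -!expr2 (speed _ Iu).
by rewrite addrAC subrr add0r mulr1.
Qed.

Lemma normal_sprod_n u v : J v -> sprod (N u v) (n v) = 0.
Proof. exact: plane_sprod_n. Qed.

(** Since [z_u] and [N] span the same plane as [l] and [e0], and [z_v] is a multiple of
    [t], removing the tangent part leaves the components on [N] and [n]. *)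
Lemma normal_partE u v w : I u -> J v ->
  normal_part z u v w = (eta * sprod w (N u v)) *: N u v - (eta * sprod w (n v)) *: n v.
Proof.
move=> Iu Jv; have [_ ex] := frame v Jv.
have [[[E F] G] W] := first_form u v Iu Jv.
rewrite /normal_part /tangent_part E F G W (meridian_du _ _ Iu) (meridian_dv _ _ Jv).
rewrite {1}(ex w) /meridian_normal !sprodDr !sprodZr.
move: (speed _ Iu) (fN0 u Iu).
move: (f u) (f1 u) (g1 u) (sprod w (l v)) (sprod w (t v)) (sprod w (n v)) (sprod w e0)
  => x x1 y1 a b c d s xN.
have -> : (eta * x ^+ 2 * (x1 * a + y1 * d) - 0 * (x * b)) / - x ^+ 2
    = - eta * (x1 * a + y1 * d) by field.
have -> : (- eta * (x * b) - 0 * (x1 * a + y1 * d)) / - x ^+ 2 = eta * b / x.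
  by field.
apply/rowP => i; rewrite !mxE; move: (l v 0 i) (t v 0 i) (n v 0 i) (e0 0 i) => l' t' n' e'.
apply/eqP; rewrite -subr_eq0; apply/eqP.
transitivity (eta * (1 + x1 ^+ 2 - y1 ^+ 2) * (a * l' - d * e')); last by rewrite s; ring.
by field.
Qed.

Lemma normal_part_eq0 u v w : I u -> J v ->
  normal_part z u v w = 0 <-> sprod w (n v) = 0 /\ sprod w (N u v) = 0.
Proof.
move=> Iu Jv; rewrite normal_partE //; split=> [|[-> ->]]; last first.
  by rewrite !mulr0 !scale0r subr0.
have Nn := normal_sprod_n u v Jv; have nn : sprod (n v) (n v) = - eta by rewrite (frE v Jv).
rewrite -scaleNr; move: (sprod w (N u v)) (sprod w (n v)) => a c H.
split; [have := congr1 (fun x : 'rV[R]_4 => sprod x (n v)) H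
       |have := congr1 (fun x : 'rV[R]_4 => sprod x (N u v)) H] => /=.
  rewrite sprod0l sprodDl !sprodZl Nn nn => <-.
  by transitivity (eta ^+ 2 * c); [rewrite eta2 mul1r|ring].
rewrite sprod0l sprodDl !sprodZl [sprod (n v) _]sprodC Nn (normal_norm _ _ Iu Jv) => <-.
by transitivity (eta ^+ 2 * a); [rewrite eta2 mul1r|ring].
Qed.

(** [h(z_u, z_u)] has only a component on [N], namely [f'' g' - g'' f'], whereas
    [h(z_v, z_v)] is obtained from the Frenet equation for [t']. *)
Lemma meridian_mean_curvature u v : I u -> J v ->
  mean_curvature z u v = - (2 * f u)^-1 *: (kappa v *: n v + (eta * Q u) *: N u v).
Proof.
move=> Iu Jv; have fN := fN0 u Iu; have fr := frE v Jv.
have h11E : h11 z u v = (f2 u * g1 u - g2 u * f1 u) *: N u v.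
  rewrite /h11 (normal_partE _ _ _ Iu Jv) (meridian_duu _ _ Iu).
  rewrite (plane_sprod_n _ _ _ Jv) (plane_sprod _ _ _ _ _ Jv).
  by rewrite mulr0 scale0r subr0 mulrA -expr2 eta2 mul1r.
have h22E : h22 z u v = - (f u * g1 u) *: N u v - (eta * (kappa v * f u)) *: n v.
  rewrite /h22 (normal_partE _ _ _ Iu Jv) (meridian_dvv _ _ Jv) (frenet_t _ Jv).
  move: (kappa v) => k; rewrite -(scaleN1r (l v)) -scaleNr.
  rewrite !sprodZl !sprodDl !sprodZl [sprod (n v) (N _ _)]sprodC (normal_sprod_n _ _ Jv).
  rewrite /meridian_normal !sprodDr !sprodZr !fr; move: (f u) (f1 u) (g1 u) => x x1 y1.
  have -> : eta * (x * (-1 * (y1 * eta + x1 * 0) + - (eta * k) * 0)) = - (eta ^+ 2 * (x * y1)).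
    by ring.
  have -> : eta * (x * (-1 * 0 + - (eta * k) * - eta)) = eta * (eta ^+ 2 * (k * x)) by ring.
  by rewrite eta2 !mul1r.
have [[[E F] G] W] := first_form u v Iu Jv.
rewrite /mean_curvature E F G W h11E h22E mulr0 scale0r subr0 /meridian_factor.
move: (kappa v) (N u v) (f u) (f1 u) (f2 u) (g1 u) (g2 u) fN => k X x x1 x2 y1 y2 xN.
apply/rowP => i; rewrite !mxE; move: (X 0 i) (n v 0 i) => X0 n0.
transitivity (- (2 * x)^-1 * (eta ^+ 2 * k * n0 + eta * (x * (x2 * y1 - y2 * x1) + y1) * X0)).
  by field.
by rewrite eta2 mul1r.
Qed.

Lemma mean_curvature_factor rho u v : I u -> J v -> Q u = rho * kappa v ->
  mean_curvature z u v = - (kappa v / (2 * f u)) *: (n v + (eta * rho) *: N u v).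
Proof.
move=> Iu Jv Qk; rewrite meridian_mean_curvature // Qk.
by apply/rowP => i; rewrite !mxE; ring.
Qed.

(** [N_u] is orthogonal to [N] because [g' g'' = f' f'']. *)
Lemma normal_derive_u u v : I u -> J v -> is_derive u 1 (N ^~ v) (g2 u *: l v + f2 u *: e0) /\
  forall a b, sprod (a *: n v + b *: N u v) (g2 u *: l v + f2 u *: e0) = 0.
Proof.
move=> Iu Jv; split=> [|a b]; first exact: (profile_du (l v) e0 (dg 1 u Iu) (df 1 u Iu)).
rewrite sprodDl !sprodZl [sprod (n v) _]sprodC (plane_sprod_n _ _ _ Jv) mulr0 add0r.
rewrite (plane_sprod _ _ _ _ _ Jv) (meridian_speed_derive hM _ Iu).
by rewrite subrr !mulr0.
Qed.

Lemma normal_derive_v u v : J v -> is_derive v 1 (N u) (g1 u *: t v).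
Proof. by move=> Jv; exact: (profile_dv (f1 u *: e0) (dl 0 v Jv)). Qed.

(** The fields [n] and [N] are parallel in the normal bundle. *)
Lemma constant_combination_parallel c1 c2 (b : R -> R -> 'rV[R]_4) :
  (forall u v, I u -> J v -> b u v = c1 *: n v + c2 *: N u v) -> normal_parallel z I J b.
Proof.
move=> bE u v Iu Jv; split; apply/(normal_part_eq0 _ _ _ Iu Jv).
  have [dN orth] := normal_derive_u u v Iu Jv.
  have db : is_derive u 1 (b ^~ v) (c2 *: (g2 u *: l v + f2 u *: e0)).
    apply: (is_derive_eqfun_on oI (fun s Is => bE s v Is Jv) Iu).
    apply: (is_derive_eq (is_derive_add (is_derive_cst (c1 *: n v) u 1)
      (is_derive_scaler c2 dN))).
    by rewrite add0r.
  rewrite /du (derive1_val db) !sprodZl (plane_sprod_n _ _ _ Jv) mulr0; split=> //.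
  by have := orth 0 1; rewrite scale0r add0r scale1r sprodC => ->; rewrite mulr0.
have db : is_derive v 1 (b u) (c1 *: derive1 n v + c2 *: (g1 u *: t v)).
  apply: (is_derive_eqfun_on oJ (fun s Js => bE u s Iu Js) Jv).
  exact: is_derive_add (is_derive_scaler c1 (dn v Jv))
    (is_derive_scaler c2 (normal_derive_v u v Jv)).
rewrite /dv (derive1_val db) (frenet_n _ Jv) !sprodDl !sprodZl.
rewrite [sprod (t v) (N _ _)]sprodC (plane_sprod_t _ _ _ Jv) (frE v Jv).
by rewrite !mulr0 addr0.
Qed.

(** Conversely, the products of a parallel normal field with the parallel fields [n]
    and [N] have zero derivatives. *)
Lemma parallel_products (b : R -> R -> 'rV[R]_4) :
  normal_parallel z I J b ->
  (forall u v, I u -> J v -> exists b1 b2, b u v = b1 *: n v + b2 *: N u v) ->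
  (forall u v, I u -> J v -> derivable (b ^~ v) u 1 ->
    is_derive u 1 (fun s => sprod (b s v) (n v)) 0 /\
    is_derive u 1 (fun s => sprod (b s v) (N s v)) 0) /\
  (forall u v, I u -> J v -> derivable (b u) v 1 ->
    is_derive v 1 (fun s => sprod (b u s) (n s)) 0 /\
    is_derive v 1 (fun s => sprod (b u s) (N u s)) 0).
Proof.
move=> par span; split=> u v Iu Jv D; have [Pu Pv] := par u v Iu Jv;
  have [b1 [b2 bE]] := span u v Iu Jv; have db := is_derive_derive1 D.
  move/(normal_part_eq0 _ _ _ Iu Jv): Pu => [] Pn PN; split.
    apply: (is_derive_eq (is_derive_sprod db (is_derive_cst (n v) u 1))).
    by rewrite -/(du b u v) Pn add0r sprodC sprod0l.
  have [dN orth] := normal_derive_u u v Iu Jv.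
  apply: (is_derive_eq (is_derive_sprod db dN)).
  by rewrite -/(du b u v) PN add0r bE orth.
have bt : sprod (b u v) (t v) = 0.
  rewrite bE sprodDl !sprodZl (plane_sprod_t _ _ _ Jv) (frE v Jv).
  by rewrite !mulr0 addr0.
move/(normal_part_eq0 _ _ _ Iu Jv): Pv => [] Pn PN; split.
  apply: (is_derive_eq (is_derive_sprod db (dn v Jv))).
  by rewrite -/(dv b u v) Pn add0r (frenet_n _ Jv) sprodZr bt mulr0.
apply: (is_derive_eq (is_derive_sprod db (normal_derive_v u v Jv))).
by rewrite -/(dv b u v) PN add0r sprodZr bt mulr0.
Qed.

Let Jn0 : J !=set0. Proof. by case: hJ. Qed.
Let In0 : I !=set0. Proof. by case: hM => -[]. Qed.

Lemma spherical_curvature_cts v : J v -> {for v, continuous kappa}.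
Proof.
by move=> Jv; exact: is_derive_continuous (is_derive_sprod (dl 2 v Jv) (dn v Jv)).
Qed.

Lemma smooth2_derivable (b : R -> R -> 'rV[R]_4) u v : smooth2_on I J b ->
  I u -> J v -> derivable (b ^~ v) u 1 /\ derivable (b u) v 1.
Proof.
move=> bs Iu Jv; have D := bs [::] u v Iu Jv.
split; apply/derivable1_diffP.
  apply: (@differentiable_comp _ _ _ _ (fun s => (s, v)) _ _ _ D).
  have dI : is_diff u (fun s : R => (s, v)) (fun s => (s, 0)) by exact: is_diff_pair.
  by [].
apply: (@differentiable_comp _ _ _ _ (fun s => (u, s)) _ _ _ D).
have dI : is_diff v (fun s : R => (u, s)) (fun s => (0, s)) by exact: is_diff_pair.
by [].
Qed.

(** The constants [c1 = <b, n>] and [c2 = <b, N>] are proportional to [<H, n>] and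
    [<H, N>], that is to [eta kappa] and [- Q]; their ratio gives [rho]. If
    [rho^2 = 1], then [H] would be null. *)
Lemma factor_of_pnmc : (forall v, J v -> kappa v <> 0) ->
  parallel_normalized_mean_curvature z I J ->
  exists2 rho, rho ^+ 2 <> 1 & forall u v, I u -> J v -> Q u = rho * kappa v.
Proof.
move=> k0 [Hnz [b [bs _ bH bpar]]].
have [[u0 Iu0] [v0 Jv0]] := (In0, Jn0).
have span u v : I u -> J v -> exists b1 b2, b u v = b1 *: n v + b2 *: N u v.
  move=> Iu Jv; have [lam [lam0 HE]] := bH u v Iu Jv.
  exists (lam^-1 * (- (2 * f u)^-1 * kappa v)), (lam^-1 * (- (2 * f u)^-1 * (eta * Q u))).
  have -> : b u v = lam^-1 *: mean_curvature z u v.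
    by rewrite HE scalerA mulVf ?scale1r // lt0r_neq0.
  rewrite (meridian_mean_curvature _ _ Iu Jv).
  by rewrite scalerA scalerDr !scalerA -!mulrA.
have [Du Dv] := parallel_products b bpar span.
pose c1 := sprod (b u0 v0) (n v0); pose c2 := sprod (b u0 v0) (N u0 v0).
have cE u v : I u -> J v -> sprod (b u v) (n v) = c1 /\ sprod (b u v) (N u v) = c2.
  move=> Iu Jv; split.
    transitivity (sprod (b u0 v) (n v)).
      apply: (zero_derive_constant (fun s => sprod (b s v) (n v)) itI _ _ _ Iu Iu0) => s Is.
      by have [] := Du s v Is Jv (smooth2_derivable _ _ _ bs Is Jv).1.
    apply: (zero_derive_constant (fun s => sprod (b u0 s) (n s)) itJ _ _ _ Jv Jv0) => s Js.
    by have [] := Dv u0 s Iu0 Js (smooth2_derivable _ _ _ bs Iu0 Js).2.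
  transitivity (sprod (b u0 v) (N u0 v)).
    apply: (zero_derive_constant (fun s => sprod (b s v) (N s v)) itI _ _ _ Iu Iu0) => s Is.
    by have [] := Du s v Is Jv (smooth2_derivable _ _ _ bs Is Jv).1.
  apply: (zero_derive_constant (fun s => sprod (b u0 s) (N u0 s)) itJ _ _ _ Jv Jv0) => s Js.
  by have [] := Dv u0 s Iu0 Js (smooth2_derivable _ _ _ bs Iu0 Js).2.
have HN u v : I u -> J v -> exists lam,
    kappa v = 2 * f u * lam * c1 * eta /\ Q u = - (2 * f u * lam * c2).
  move=> Iu Jv; have [lam [_ HE]] := bH u v Iu Jv; exists lam.
  have [<- <-] := cE u v Iu Jv; have fN := fN0 u Iu.
  have Nn := normal_sprod_n u v Jv.
  have P1 : lam * sprod (b u v) (n v) = eta * kappa v / (2 * f u).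
    rewrite -sprodZl -HE meridian_mean_curvature // sprodZl sprodDl !sprodZl Nn (frE v Jv).
    by field.
  have P2 : lam * sprod (b u v) (N u v) = - (Q u / (2 * f u)).
    rewrite -sprodZl -HE meridian_mean_curvature // sprodZl sprodDl !sprodZl.
    rewrite normal_norm // [sprod (n v) _]sprodC Nn mulr0 add0r.
    by transitivity (- (eta ^+ 2 * Q u / (2 * f u))); [field|rewrite eta2 mul1r].
  rewrite -!(mulrA _ lam) P1 P2; split; last by field.
  by transitivity (eta ^+ 2 * kappa v); [rewrite eta2 mul1r|field].
have c1N : c1 != 0.
  apply/eqP => c10; have [lam [+ _]] := HN u0 v0 Iu0 Jv0.
  by rewrite c10 mulr0 mul0r; exact: k0.
have QE u v : I u -> J v -> Q u = - eta * c2 / c1 * kappa v.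
  move=> Iu Jv; have [lam [-> ->]] := HN u v Iu Jv.
  by transitivity (- (eta ^+ 2 * (2 * f u * lam * c2))); [rewrite eta2 mul1r|field].
exists (- eta * c2 / c1) => // r1; have [_] := Hnz u0 v0 Iu0 Jv0; apply.
rewrite (mean_curvature_factor _ _ _ Iu0 Jv0 (QE u0 v0 Iu0 Jv0)).
move: r1; set rho := (- eta * c2 / c1) => r1.
have Nn := normal_sprod_n u0 v0 Jv0.
rewrite sprodZl sprodZr sprodDl !sprodDr !sprodZl !sprodZr normal_norm //.
rewrite [sprod (n v0) (N _ _)]sprodC Nn (frE v0 Jv0).
set X := (X in X * (X * _)); transitivity (X * X * eta * (eta ^+ 2 * rho ^+ 2 - 1)); first by ring.
by rewrite r1 eta2 mulr1 subrr mulr0.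
Qed.

Lemma separable_normal_combination c1 c2 :
  separable I J (fun u v => c1 *: n v + c2 *: N u v).
Proof.
have sc (c : R) : smooth_on I (cst c) by apply: elementary_smooth oI _; exact: elem_cst.
have sm (c : R) (h : R -> R) : smooth_on I h -> smooth_on I (fun u => cst c u * h u).
  move=> hs; apply: elementary_smooth oI _.
  by apply: elem_mul; [exact: elem_cst|exact: elem_smooth].
have se : smooth_on J (cst e0).
  apply/(smooth_on_coordP oJ) => i.
  by apply: (elementary_smooth oJ); exact: (elem_cst _ (e0 0 i)).
have S1 := separable_scale oJ (sc c1) ns.
have S2 := separable_scale oJ (sm c2 _ (smooth_derive gs)) ls.
have S3 := separable_scale oJ (sm c2 _ (smooth_derive fs)) se.
have S23 := separable_add _ _ _ _ _ S2 S3 (fun u v _ _ => erefl).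
apply: (separable_add _ _ _ _ _ S1 S23) => u v _ _.
by rewrite /meridian_normal scalerDr !scalerA.
Qed.

(** [H] is a multiple of [n + eta rho N], whose square is the constant
    [eta (rho^2 - 1)]; the multiple [- kappa / (2 f)] has a constant sign since [kappa]
    and [f] are continuous and do not vanish. *)
Lemma pnmc_of_factor rho : (forall v, J v -> kappa v <> 0) -> rho ^+ 2 <> 1 ->
  (forall u v, I u -> J v -> Q u = rho * kappa v) ->
  parallel_normalized_mean_curvature z I J.
Proof.
move=> k0 r1 Qk.
have HE u v : I u -> J v -> mean_curvature z u v =
    - (kappa v / (2 * f u)) *: (n v + (eta * rho) *: N u v).
  by move=> Iu Jv; apply: mean_curvature_factor => //; exact: Qk.
have XX u v : I u -> J v -> sprod (n v + (eta * rho) *: N u v) (n v + (eta * rho) *: N u v)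
    = eta * (rho ^+ 2 - 1).
  move=> Iu Jv; have Nn := normal_sprod_n u v Jv.
  rewrite sprodDl !sprodDr !sprodZl !sprodZr normal_norm //.
  rewrite [sprod (n v) (N _ _)]sprodC Nn (frE v Jv).
  by transitivity (eta * (eta ^+ 2 * rho ^+ 2 - 1)); [ring|rewrite eta2 mul1r].
have r1N : rho ^+ 2 - 1 != 0 by rewrite subr_eq0; apply/eqP.
have kN v : J v -> kappa v != 0 by move=> Jv; apply/eqP; exact: k0.
have fc u : I u -> {for u, continuous f} by move=> Iu; exact: is_derive_continuous (df 0 u Iu).
have [sf sf1 fS] := continuous_sign itI fc fN0.
have [sk sk1 kS] := continuous_sign itJ spherical_curvature_cts kN.
have HH u v : I u -> J v -> sprod (mean_curvature z u v) (mean_curvature z u v) != 0.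
  move=> Iu Jv; rewrite HE // sprodZl sprodZr XX // !mulf_neq0 // ?oppr_eq0 ?mulf_neq0 ?kN //;
  by rewrite invr_eq0 mulf_neq0 ?fN0 // pnatr_eq0.
split=> [u v Iu Jv|].
  split; last exact/eqP/HH.
  by move=> H0; have := HH u v Iu Jv; rewrite H0 sprod0l eqxx.
pose r := Num.sqrt `|rho ^+ 2 - 1|.
have r0 : 0 < r by rewrite sqrtr_gt0 normr_gt0.
have r2 : r ^+ 2 = `|rho ^+ 2 - 1| by rewrite sqr_sqrtr.
(* [- sf sk] is the sign of [- kappa / (2 f)], as [H] must be a positive multiple
   of [b]. *)
pose c := - (sf * sk) / r.
have c2 : c ^+ 2 = `|rho ^+ 2 - 1|^-1.
  rewrite /c expr_div_n r2 sqrrN exprMn.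
  by case: sf1 => ->; case: sk1 => ->; rewrite ?sqrrN !expr1n ?mul1r.
exists (fun u v => c *: n v + (c * (eta * rho)) *: N u v); split.
- exact: separable_smooth2 oI oJ _ (separable_normal_combination _ _).
- move=> u v Iu Jv; rewrite -scalerA -scalerDr.
  rewrite /unitv !sprodZl !sprodZr XX // mulrA -expr2 c2.
  have [h|h] := ger0P (rho ^+ 2 - 1);
    [case: eta1 => e1; [left|right]|case: eta1 => e1; [right|left]];
  by rewrite e1; field.
- move=> u v Iu Jv; exists (`|kappa v| / (2 * `|f u|) * r); split.
    by rewrite mulr_gt0 // divr_gt0 ?mulr_gt0 ?normr_gt0 ?kN ?fN0.
  rewrite HE // -[in RHS]scalerA -scalerDr !scalerA; congr (_ *: _).
  have nf : `|f u| != 0 by rewrite normr_eq0 fN0.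
  rewrite (fS u Iu) (kS v Jv) /c !normrM !normr_id.
  by case: sf1 => ->; case: sk1 => ->; rewrite ?normrN !normr1 !mul1r; field; rewrite ?nf ?gt_eqF.
- exact: (constant_combination_parallel c (c * (eta * rho))).
Qed.

(** If [H] is parallel, its component [- kappa / (2 f)] on [n] is constant in [u]. If
    [f] is constant, then [Q = g' <> 0], so [rho <> 0] and [kappa] is constant too. *)
Lemma parallel_mean_curvatureP rho : (forall v, J v -> kappa v <> 0) ->
  (forall u v, I u -> J v -> Q u = rho * kappa v) ->
  parallel_mean_curvature z I J <-> constant_on I f.
Proof.
move=> k0 Qk.
have [[u0 Iu0] [v0 Jv0]] := (In0, Jn0).
have HE u v : I u -> J v -> mean_curvature z u v =
    - (kappa v / (2 * f u)) *: (n v + (eta * rho) *: N u v).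
  by move=> Iu Jv; apply: mean_curvature_factor => //; exact: Qk.
split=> [par|fc].
  pose p u := - (kappa v0 / 2) * (f u)^-1.
  have dp u : I u -> is_derive u 1 p (derive1 p u).
    move=> Iu; apply: is_derive_derive1; have [fd _] := df 0 u Iu.
    by have [] := is_derive_mul (is_derive_cst (- (kappa v0 / 2)) u 1)
      (is_derive_derive1 (derivableV (fN0 u Iu) fd)).
  suff pc : constant_on I p.
    move=> s t Is It; have /mulfI := pc s t Is It.
    rewrite oppr_eq0 mulf_neq0 ?invr_eq0 ?pnatr_eq0 //.
      by move=> /(_ isT) /invr_inj.
    exact/eqP/k0.
  apply: (zero_derive_constant p itI) => u Iu.
  have [/(normal_part_eq0 _ _ _ Iu Jv0) [Hn _] _] := par u v0 Iu Jv0.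
  have Hp s : I s -> mean_curvature z s v0 = p s *: (n v0 + (eta * rho) *: N s v0).
    move=> Is; rewrite (HE _ _ Is Jv0) /p; congr (_ *: _).
    by move: (f s) (fN0 s Is) => x xN; field.
  have pE s : I s -> p s = - eta * sprod (mean_curvature z s v0) (n v0).
    move=> Is; rewrite (Hp _ Is) sprodZl sprodDl sprodZl (normal_sprod_n _ _ Jv0) (frE v0 Jv0).
    by move: (p s) => x; transitivity (eta ^+ 2 * x); [rewrite eta2 mul1r|ring].
  have dH : derivable (mean_curvature z ^~ v0) u 1.
    have E s : I s -> mean_curvature z s v0 = p s *: n v0 +
        ((p s * g1 s) *: ((eta * rho) *: l v0) + (p s * f1 s) *: ((eta * rho) *: e0)).
      move=> Is; rewrite (Hp _ Is) /meridian_normal !scalerDr !scalerA.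
      by move: (p s) (f1 s) (g1 s) => x y w; congr (_ + (_ *: _ + _ *: _)); ring.
    by have [] := is_derive_eqfun_on oI E Iu (is_derive_add (is_derive_scalel (n v0) (dp u Iu))
      (profile_du ((eta * rho) *: l v0) ((eta * rho) *: e0)
        (is_derive_mul (dp u Iu) (dg 1 u Iu)) (is_derive_mul (dp u Iu) (df 1 u Iu)))).
  apply: (is_derive_eqfun_on oI pE Iu).
  apply: (is_derive_eq (is_derive_scaler (- eta)
    (is_derive_sprod (is_derive_derive1 dH) (is_derive_cst (n v0) u 1)))).
  by rewrite -/(du _ u v0) Hn add0r sprodC sprod0l scaler0.
have rN : rho != 0.
  apply/eqP => r0; have [_] := constant_f_factor hM fc u0 Iu0.
  by rewrite (Qk u0 v0) // r0 mul0r eqxx.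
pose c := - (kappa v0 / (2 * f u0)).
apply: (constant_combination_parallel c (c * (eta * rho))) => u v Iu Jv.
rewrite HE // scalerDr scalerA (fc u u0) //.
by rewrite (_ : kappa v = kappa v0) //; apply: (mulfI rN); rewrite -!(Qk u0).
Qed.

Lemma meridian_surface_classification : (forall v, J v -> kappa v <> 0) ->
  (parallel_normalized_mean_curvature z I J /\ ~ parallel_mean_curvature z I J
   <-> case_i I J f g kappa \/ case_ii I J f g kappa).
Proof.
move=> k0; apply: iff_trans (meridian_classification hM J kappa Jn0 k0).
split=> [[/(factor_of_pnmc k0) [rho r1 Qk] npar]|[[rho r1 Qk] fnc]].
  by split; [exists rho|move=> fc; apply: npar; apply/(parallel_mean_curvatureP rho k0 Qk)].
split; first exact: (pnmc_of_factor rho k0 r1 Qk).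
by move=> /(parallel_mean_curvatureP rho k0 Qk).
Qed.

End MeridianSurface.

(** * The two types of meridian surfaces *)

Section Curves.
Context {R : realType} {I J : set R} {f g : R -> R} {n : R -> 'rV[R]_4}.
Hypotheses (hM : meridian_curve I f g) (hJ : open_interval J).

(** Common form of both types: [S] is the 3-space that contains [l], and [e0] is
    the direction of the axis. *)
Lemma classification_of_curve (eta : R) (e0 : 'rV[R]_4) (l : R -> 'rV[R]_4) (S : set 'rV[R]_4) :
  eta = 1 \/ eta = -1 -> sprod e0 e0 = - eta -> (forall x, S x -> sprod x e0 = 0) ->
  smooth_on J l -> (forall v, S (l v) /\ sprod (l v) (l v) = eta) ->
  unit_speed eta J l -> spherical_normal S J l n ->
  let z u v := f u *: l v + g u *: e0 in
  let kappa := spherical_curvature l n in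
  (forall v, J v -> kappa v <> 0) ->
  (parallel_normalized_mean_curvature z I J /\ ~ parallel_mean_curvature z I J
   <-> case_i I J f g kappa \/ case_ii I J f g kappa).
Proof.
move=> eta1 ee Se ls lS us [ns nS].
apply: (meridian_surface_classification hM hJ eta1 ls ns) => v Jv.
have [nv [[_ _ nU] [lt ln tn]]] := nS v Jv; have [lv ll] := lS v.
have te : sprod (derive1 l v) e0 = 0.
  have dl := smooth_is_derive 0 v ls Jv.
  have le0 s : sprod (l s) (cst e0 s) = 0 by apply: Se; have [] := lS s.
  have := derive1_val (is_derive_sprod dl (is_derive_cst e0 v 1)).
  rewrite [sprod (l v) 0]sprodC sprod0l addr0 => <-.
  by under eq_fun do rewrite le0; rewrite derive1_cst.
by apply: (meridian_frameP eta1) => //; split=> //; [exact: us|exact: Se..].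
Qed.

Lemma sprod_e (i j : nat) : (0 < i <= 4)%N -> (0 < j <= 4)%N ->
  sprod (e i : 'rV[R]_4) (e j) = (if (i <= 2)%N then 1 else -1) *+ (i == j).
Proof.
case: i => [|[|[|[|[|//]]]]] // _; case: j => [|[|[|[|[|//]]]]] // _;
by rewrite sprodE !mxE /= ?mulr1n ?mulr0n; ring.
Qed.

Lemma span3_orthogonal (i j k m : nat) (x : 'rV[R]_4) : span3 i j k x ->
  sprod (e i : 'rV[R]_4) (e m) = 0 -> sprod (e j : 'rV[R]_4) (e m) = 0 ->
  sprod (e k : 'rV[R]_4) (e m) = 0 ->
  sprod x (e m) = 0.
Proof.
by move=> [a [b [c ->]]] im jm km; rewrite !sprodL im jm km !mulr0 !addr0.
Qed.

Lemma cosh_sinh (x : R) : cosh x ^+ 2 - sinh x ^+ 2 = 1.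
Proof.
have xx : expR x * expR (- x) = 1 by rewrite expRN divff // gt_eqF ?expR_gt0.
by rewrite /cosh /sinh -[RHS]xx; field.
Qed.

(** With suitable [x], [y], [w] among the basis vectors this is either of the two
    parametrizations of [l]. *)
Lemma smooth_hyperbolic_curve (w1 w2 : R -> R) (x y w : 'rV[R]_4) :
  open J -> smooth_on J w1 -> smooth_on J w2 ->
  smooth_on J (fun v => (cosh (w1 v) * cos (w2 v)) *: x + (cosh (w1 v) * sin (w2 v)) *: y
    + sinh (w1 v) *: w).
Proof.
move=> oJ /elem_smooth s1 /elem_smooth s2.
pose E (s : R) v := expR (cst s v * w1 v).
have sE s : elementary J (E s).
  by apply: (elem_exp _ (fun v => cst s v * w1 v)); apply: elem_mul; first exact: elem_cst.
have hs s : elementary J (fun v => (E 1 v + cst s v * E (-1) v) * cst 2^-1 v).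
  apply: elem_mul; last exact: elem_cst.
  by apply: elem_add => //; apply: elem_mul; first exact: elem_cst.
have cE v : cosh (w1 v) = (E 1 v + cst 1 v * E (-1) v) * cst 2^-1 v.
  by rewrite /cosh /E /= !mul1r mulN1r.
have sE' v : sinh (w1 v) = (E 1 v + cst (-1) v * E (-1) v) * cst 2^-1 v.
  by rewrite /sinh /E /= mul1r !mulN1r.
apply/(smooth_on_coordP oJ) => i; apply: (elementary_smooth oJ).
under eq_fun do rewrite !mxE cE sE'.
apply: elem_add; first apply: elem_add.
- apply: (elem_mul _ _ (cst (x 0 i))); last exact: elem_cst.
  by apply: elem_mul => //; exact: (elem_cos _ w2).
- apply: (elem_mul _ _ (cst (y 0 i))); last exact: elem_cst.
  by apply: elem_mul => //; exact: (elem_sin _ w2).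
- by apply: (elem_mul _ _ (cst (w 0 i))); last exact: elem_cst.
Qed.

Lemma hyperbolic_curve_norm (eta : R) (a b : R) (x y w : 'rV[R]_4) :
  sprod x x = eta -> sprod y y = eta -> sprod w w = - eta ->
  sprod x y = 0 -> sprod x w = 0 -> sprod y w = 0 ->
  let p := (cosh a * cos b) *: x + (cosh a * sin b) *: y + sinh a *: w in
  sprod p p = eta.
Proof.
move=> xx yy ww xy xw yw /=.
rewrite !sprodL (sprodC y x) (sprodC w x) (sprodC w y) xx yy ww xy xw yw.
transitivity (eta * (cosh a ^+ 2 * (cos b ^+ 2 + sin b ^+ 2) - sinh a ^+ 2)); first by ring.
by rewrite cos2Dsin2 mulr1 cosh_sinh mulr1.
Qed.

End Curves.

Theorem theorem5p1 (R : realType) (I J : set R) (f g w1 w2 : R -> R)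
    (n : R -> 'rV[R]_4) :
  meridian_curve I f g ->
  curve_parameters J w1 w2 ->
  (let l := curve_a w1 w2 in
   let z := surface_a f g l in
   let kappa := spherical_curvature l n in
   unit_speed 1 J l ->
   spherical_normal (span3 1 2 3) J l n ->
   (forall v : R, J v -> kappa v <> 0) ->
   (parallel_normalized_mean_curvature z I J /\ ~ parallel_mean_curvature z I J
    <-> case_i I J f g kappa \/ case_ii I J f g kappa))
  /\
  (let l := curve_b w1 w2 in
   let z := surface_b f g l in
   let kappa := spherical_curvature l n in
   unit_speed (-1) J l ->
   spherical_normal (span3 2 3 4) J l n ->
   (forall v : R, J v -> kappa v <> 0) ->
   (parallel_normalized_mean_curvature z I J /\ ~ parallel_mean_curvature z I J
    <-> case_i I J f g kappa \/ case_ii I J f g kappa)).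
Proof.
move=> hM [hJ w1s w2s]; have oJ : open J by case: hJ.
split=> l z kappa us ns.
  apply: (classification_of_curve hM hJ 1 (e 4) l _ _ _ _ _ _ us ns).
  - by left.
  - by rewrite sprod_e.
  - by move=> x /span3_orthogonal; apply; rewrite sprod_e.
  - exact: smooth_hyperbolic_curve.
  - move=> v; split.
      by exists (cosh (w1 v) * cos (w2 v)), (cosh (w1 v) * sin (w2 v)), (sinh (w1 v)).
    by apply: hyperbolic_curve_norm; rewrite sprod_e.
have lE : l = fun v => (cosh (w1 v) * cos (w2 v)) *: e 3 + (cosh (w1 v) * sin (w2 v)) *: e 4
    + sinh (w1 v) *: e 2.
  by apply/funext => v; rewrite /l /curve_b -addrA addrC.
have zE : z = fun u v => f u *: l v + g u *: e 1.
  by apply/funext => u; apply/funext => v; rewrite /z /surface_b addrC.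
rewrite zE; apply: (classification_of_curve hM hJ (-1) (e 1) l _ _ _ _ _ _ us ns).
- by right.
- by rewrite sprod_e // opprK.
- by move=> x /span3_orthogonal; apply; rewrite sprod_e.
- by rewrite lE; exact: smooth_hyperbolic_curve.
- move=> v; split.
    by exists (sinh (w1 v)), (cosh (w1 v) * cos (w2 v)), (cosh (w1 v) * sin (w2 v)).
  by rewrite lE; apply: hyperbolic_curve_norm; rewrite sprod_e // opprK.
Qed.
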